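(* Let $d\ge 2$ and $Y=\mathbb{Z}^d$, let $\ell\in\mathbb{R}^d$ with $|\ell|_1=1$, let $\kappa\in(0,1/(2d)]$, and let $\mathbb{P}$ be a probability measure on the space $\Omega$ of environments such that the family $(\omega(x,\cdot,\cdot))_{x\in Y}$ is i.i.d. under $\mathbb{P}$. Suppose $\mathbb{E}[\delta^0]>0$. Then for $\mathbb{P}$-almost every $\omega$ the excited random walk is transient in direction $\ell$, i.e. $P_{0,\omega}$-a.s. $X_n\cdot\ell\to\infty$ as $n\to\infty$.
   Context: The space of environments is the set $\Omega$ of all $\omega=(\omega(x,e,i))_{x\in Y,\ e\in\mathbb{Z}^d,\ |e|=1,\ i\in\mathbb{N},\ i\ge1}$ with $\omega(x,e,i)\in[\kappa,1-\kappa]$ such that for all $x\in Y$ and $i\ge 1$: $\sum_{|e|=1}\omega(x,e,i)=1$ and $\sum_{|e|=1}\omega(x,e,i)\,e\cdot\ell\ge 0$. $\Omega$ carries the product topology and its Borel $\sigma$-algebra. Here $\omega(x,\cdot,\cdot)=(\omega(x,e,i))_{|e|=1,i\ge1}$; no independence is assumed between different $i$ or different $e$ at the same site $x$. An excited random walk (ERW) starting at $x\in Y$ in the environment $\omega\in\Omega$ is a $Y$-valued process $(X_n)_{n\ge0}$ on a probability space with measure $P_{x,\omega}$ such that $P_{x,\omega}[X_0=x]=1$ and, with $H_n=(X_m)_{0\le m\le n}$, $P_{x,\omega}$-a.s. for all $n\ge 0$ and all $|e|=1$, $$P_{x,\omega}[X_{n+1}=X_n+e\mid H_n]=\omega(X_n,e,\#\{m\le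 n\mid X_m=X_n\}).$$ $\mathbb{E}$ is expectation with respect to $\mathbb{P}$, and $\delta^x(\omega):=\sum_{i\ge1}\sum_{|e|=1}\omega(x,e,i)\,e\cdot\ell\in[0,\infty]$. *)

(* Defs.v *)
From HB Require Import structures.
From mathcomp Require Import all_boot all_order all_algebra.
From mathcomp Require Import all_classical all_reals all_analysis.
From mathcomp Require Import ring lra.

Set Implicit Arguments.
Unset Strict Implicit.
Unset Printing Implicit Defensive.

Import Order.TTheory GRing.Theory Num.Theory.
Import numFieldNormedType.Exports.

Local Open Scope classical_set_scope.
Local Open Scope ring_scope.

Definition lattice (d : nat) : Type := 'rV[int]_d.

HB.instance Definition _ d := Countable.copy (lattice d) 'rV[int]_d.
HB.instance Definition _ d := GRing.Zmodule.copy (lattice d) 'rV[int]_d.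
HB.instance Definition _ d := isPointed.Build (lattice d) 0.
HB.instance Definition _ d := @isMeasurable.Build default_measure_display
  (lattice d) discrete_measurable discrete_measurable0
  discrete_measurableC discrete_measurableU.

Definition dotp {R : realType} {d : nat} (x : lattice d) (l : 'rV[R]_d) : R :=
  \sum_(j < d) (x 0 j)%:~R * l 0 j.

(* The 2d unit vectors of Z^d: (j, false) stands for + e_j and (j, true) for
   - e_j. Lemmas stepv_inj and stepvP below show that stepv is a bijection onto
   {e in Z^d : |e| = 1}. *)
Notation step d := ('I_d * bool)%type.

Definition stepv {d : nat} (e : step d) : lattice d :=
  (-1) ^+ e.2 *: delta_mx 0 e.1.

Lemma stepvE d (e : step d) j :
  stepv e 0 j = (-1) ^+ e.2 * (j == e.1)%:R.
Proof. by rewrite !mxE eqxx. Qed.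

Lemma stepv_inj d : injective (@stepv d).
Proof.
move=> [i b] [j c] /matrixP H.
have := H 0 i; rewrite !stepvE/= eqxx.
have [<-|_] := eqVneq i j; first by case: b H; case: c.
by case: b {H}; rewrite ?mulr0.
Qed.

Lemma stepvP d (x : lattice d) :
  (exists e, x = stepv e) <-> \sum_(j < d) x 0 j ^+ 2 = 1.
Proof.
split=> [[e ->]|H].
  rewrite (bigD1 e.1)//= big1 ?addr0; last first.
    by move=> i /negPf ie; rewrite stepvE ie mulr0 expr0n.
  by rewrite stepvE eqxx mulr1 sqrr_sign.
have [j xj] : exists j, x 0 j != 0.
  apply: contrapT => /forallNP h; move: H; rewrite big1// => i _.
  by have /negP/negPn/eqP -> := h i; rewrite expr0n.
have xj1 : 1 <= x 0 j ^+ 2.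
  by rewrite -gtz0_ge1 lt_def sqr_ge0 andbT sqrf_eq0.
move: (H); rewrite (bigD1 j)//= => H'.
have S0 : 0 <= \sum_(i < d | i != j) x 0 i ^+ 2.
  by apply: sumr_ge0 => i _; exact: sqr_ge0.
have Seq0 : \sum_(i < d | i != j) x 0 i ^+ 2 = 0 by lra.
have xi i : i != j -> x 0 i = 0.
  move=> ij; apply/eqP; rewrite -sqrf_eq0; apply/eqP.
  by move/psumr_eq0P: Seq0; apply=> // k _; exact: sqr_ge0.
have /eqP : x 0 j ^+ 2 = 1 by lra.
rewrite sqrf_eq1 => /orP[]/eqP xjE; [exists (j, false)|exists (j, true)];
  apply/rowP => i; rewrite stepvE/=;
  by have [->|/xi ->] := eqVneq i j; rewrite ?mulr1 ?mulr0.
Qed.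

(* i : nat is 0-based: coordinate (x, e, i) is omega(x, e, i + 1), the jump
   probability in direction e at the (i + 1)-st visit to x. *)
Definition is_environment {R : realType} {d : nat} (l : 'rV[R]_d) (kappa : R)
    : set {ptws (lattice d * step d * nat) -> R} :=
  [set w | (forall x e i, kappa <= w (x, e, i) <= 1 - kappa) /\
           (forall x i, \sum_(e : step d) w (x, e, i) = 1) /\
           (forall x i, 0 <= \sum_(e : step d)
                              w (x, e, i) * dotp (stepv e) l)].

(* The hypotheses on d and kappa serve only to show that the space is
   nonempty, as required of a measurableType. *)
Definition environment {R : realType} {d : nat} (l : 'rV[R]_d) (kappa : R)
    (hd : (2 <= d)%N) (hk0 : 0 < kappa) (hk1 : kappa <= (2 * d%:R)^-1) : Type :=
  set_type (is_environment l kappa).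

Section environment_space.
Context {R : realType} {d : nat} (l : 'rV[R]_d) (kappa : R).
Context (hd : (2 <= d)%N) (hk0 : 0 < kappa) (hk1 : kappa <= (2 * d%:R)^-1).

Local Notation Omega := (environment l hd hk0 hk1).

Lemma uniform_environment :
  is_environment l kappa (fun=> (2 * d%:R)^-1).
Proof.
have d2 : 2 <= d%:R :> R by rewrite ler_nat.
have dV : (2 * d%:R)^-1 <= 2^-1 :> R.
  by rewrite lef_pV2 ?posrE ?mulr_gt0 //; lra.
split=> [x e i|]; first by apply/andP; split=> //=; move: hk1 dV; set v := _^-1; lra.
split=> x i.
  rewrite sumr_const card_prod card_ord card_bool -[LHS]mulr_natl natrM.
  by rewrite (mulrC 2) mulfV// mulf_neq0//; apply/eqP; lra.
rewrite -mulr_sumr mulr_ge0 ?invr_ge0 ?mulr_ge0//.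
rewrite -(pair_bigA _ (fun j b => dotp (stepv (j, b)) l))/= big1// => j _.
rewrite big_bool/= /dotp -big_split/= big1// => k _.
by rewrite !stepvE/= expr1 expr0 mulN1r mul1r intrN mulNr addNr.
Qed.

HB.instance Definition _ :=
  Topological.copy Omega (set_type (is_environment l kappa)).
HB.instance Definition _ :=
  isPointed.Build Omega (SigSub (mem_set uniform_environment)).

End environment_space.

Definition borel (T : ptopologicalType) := g_sigma_algebraType (@open T).

Definition env_at {R : realType} {d : nat} {l : 'rV[R]_d} {kappa : R}
    (w : set_type (is_environment l kappa)) (x : lattice d) (e : step d) (i : nat) : R :=
  \val w (x, e, i).

Definition site_env (R : realType) (d : nat) : Type :=
  {ptws (step d * nat) -> R}.

HB.instance Definition _ (R : realType) d :=
  Topological.copy (site_env R d) {ptws (step d * nat) -> R}.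
HB.instance Definition _ (R : realType) d :=
  isPointed.Build (site_env R d) (fun=> 0).

Definition env_site {R : realType} {d : nat} {l : 'rV[R]_d} {kappa : R}
    (x : lattice d) (w : set_type (is_environment l kappa)) : site_env R d :=
  fun p => env_at w x p.1 p.2.

Definition mutually_independent {R : realType} {dT dV : measure_display}
    {T : measurableType dT} {V : measurableType dV} {I : eqType}
    (P : probability T R) (Z : I -> T -> V) : Prop :=
  forall (s : seq I) (A : I -> set V), uniq s ->
    (forall i, measurable (A i)) ->
    P (\bigcap_(i in [set` s]) Z i @^-1` A i)
      = (\prod_(i <- s) P (Z i @^-1` A i))%E.

Definition identically_distributed {R : realType} {dT dV : measure_display}
    {T : measurableType dT} {V : measurableType dV} {I : Type}
    (P : probability T R) (Z : I -> T -> V) : Prop :=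
  forall (i j : I) (A : set V), measurable A ->
    P (Z i @^-1` A) = P (Z j @^-1` A).

Definition iid {R : realType} {dT dV : measure_display}
    {T : measurableType dT} {V : measurableType dV} {I : eqType}
    (P : probability T R) (Z : I -> T -> V) : Prop :=
  (forall i, measurable_fun setT (Z i)) /\
  mutually_independent P Z /\ identically_distributed P Z.

Definition drift {R : realType} {d : nat} {l : 'rV[R]_d} {kappa : R}
    (x : lattice d) (w : set_type (is_environment l kappa)) : \bar R :=
  (\sum_(0 <= i <oo)
    (\sum_(e : step d) env_at w x e i * dotp (stepv e) l)%R%:E)%E.

(* f is a version of the conditional probability Q[A | G] *)
Definition cond_prob_version {R : realType} {dT : measure_display}
    {T : measurableType dT} (Q : probability T R) (G : set (set T))
    (A : set T) (f : T -> R) : Prop :=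
  (forall B : set R, measurable B -> G (f @^-1` B)) /\
  Q.-integrable setT (EFin \o f) /\
  (forall B, G B -> (\int[Q]_(t in B) (f t)%:E = Q (A `&` B))%E).

(* sigma(X_0, ..., X_n) *)
Definition history {d : nat} {dT : measure_display} {T : measurableType dT}
    (X : nat -> T -> lattice d) (n : nat) : set (set T) :=
  <<s \bigcup_(m in `I_n.+1) preimage_set_system setT (X m) measurable >>.

Definition visits {d : nat} {T : Type} (X : nat -> T -> lattice d) (n : nat)
    (t : T) : nat :=
  #|[pred m : 'I_n.+1 | X m t == X n t]|.

(* The predecessor below compensates for the 0-based indexing of visits in
   environments; visits X n t >= 1 always holds. *)
Definition is_ERW {R : realType} {d : nat} {l : 'rV[R]_d} {kappa : R}
    (x : lattice d) (w : set_type (is_environment l kappa))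
    {dT : measure_display} {T : measurableType dT} (Q : probability T R)
    (X : nat -> {RV Q >-> lattice d}) : Prop :=
  Q [set t | X 0%N t = x] = 1%E /\
  exists p : nat -> step d -> T -> R,
    (forall n e, cond_prob_version Q (history (fun m => X m : T -> lattice d) n)
       [set t | X n.+1 t = X n t + stepv e] (p n e)) /\
    {ae Q, forall t, forall n e,
       p n e t = env_at w (X n t) e
                   (visits (fun m => X m : T -> lattice d) n t).-1}.

Definition transient_in_direction {R : realType} {d : nat} (l : 'rV[R]_d)
    {dT : measure_display} {T : measurableType dT} (Q : probability T R)
    (X : nat -> {RV Q >-> lattice d}) : Prop :=
  {ae Q, forall t, dotp (X n t) l @[n --> \oo] --> +oo}.

(* Main.v *)
(** The height [x . l] of the walk is a submartingale whose compensator is the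
    drift consumed so far, so the expected drift consumed before level [K] is
    reached is at most [K + 1].  A fresh site yields a fixed positive amount of
    drift on average: with probability bounded below the walk steps back and
    forth to it until it uses a cookie with positive mean drift, and whether the
    site is reached is independent of its environment.  Hence the expected
    number of sites visited before level [K] is at most linear in [K].

    Call a record a time at which the walk is strictly higher than ever before,
    and suppose that from every record, with probability at least [3/4], the walk
    still comes back below the record arbitrarily late.  Then it crosses the
    slab of width one above the record again and again.  As [d >= 2] there are
    arbitrarily long paths inside a slab, so each crossing has a chance bounded
    below to find a new site unless many sites of the slab have already been
    visited; thus the expected number of sites per slab would be arbitrarily
    large, against the linear bound.  So there is a time [t] such that for every
    horizon [n] some record is not undercut between the times [t] and [t + n]
    after it, with probability at least [1/4].

    The environment above a record is fresh and the steps below it cost at most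
    a factor [kappa] each, so from every record, whatever the past, the walk
    stays above the record from [t] steps later on for ever with probability at
    least [kappa ^ t / 4].  Since the walk reaches every level, it almost surely
    has a successful trial of this kind above any prescribed level. *)
Require Import Defs.
From mathcomp Require Import all_boot all_order all_algebra.
From mathcomp Require Import all_classical all_reals all_analysis.
From mathcomp Require Import measurable_realfun ring lra zify.
Import Order.TTheory GRing.Theory Num.Theory.
Import numFieldNormedType.Exports.

Set Implicit Arguments.
Unset Strict Implicit.
Unset Printing Implicit Defensive.

Local Open Scope ring_scope.

(** * Sums over the extensions of a path *)

Section TreeSums.
Context {R : numDomainType} {A : finType}.
Implicit Types (F G : seq A -> R) (h g : seq A) (n m : nat) (V : pred (seq A)).

Fixpoint tsum n F h : R :=
  if n is n'.+1 then \sum_(e : A) tsum n' F (e :: h) else F h.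

Lemma tsumS n F h : tsum n.+1 F h = \sum_(e : A) tsum n F (e :: h).
Proof. by []. Qed.

Lemma tsum_add m n F h : tsum (m + n) F h = tsum m (tsum n F) h.
Proof. by elim: m h => //= m IH h; apply: eq_bigr. Qed.

Lemma ler_tsum n F G h :
  (forall g, size g = n -> F (g ++ h) <= G (g ++ h)) ->
  tsum n F h <= tsum n G h.
Proof.
elim: n h => [|n IH] h H /=; first exact: (H [::]).
apply: ler_sum => e _; apply: IH => g sg.
by rewrite -cat_rcons; apply: H; rewrite size_rcons sg.
Qed.

Lemma eq_tsum n F G h :
  (forall g, size g = n -> F (g ++ h) = G (g ++ h)) ->
  tsum n F h = tsum n G h.
Proof. by move=> H; apply/eqP; rewrite eq_le !ler_tsum// => g /H ->. Qed.

Lemma tsumD n F G h :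
  tsum n (fun g => F g + G g) h = tsum n F h + tsum n G h.
Proof. by elim: n h => //= n IH h; rewrite -big_split; apply: eq_bigr. Qed.

Lemma tsumZ n c F h : tsum n (fun g => c * F g) h = c * tsum n F h.
Proof. by elim: n h => //= n IH h; rewrite mulr_sumr; apply: eq_bigr. Qed.

Lemma tsumB n F G h :
  tsum n (fun g => F g - G g) h = tsum n F h - tsum n G h.
Proof.
rewrite -[RHS]/(_ + - _) -mulN1r -tsumZ -tsumD.
by apply: eq_tsum => g _; rewrite mulN1r.
Qed.

Lemma tsum_sum (I : Type) (r : seq I) (P : pred I) n (F : I -> seq A -> R) h :
  tsum n (fun g => \sum_(i <- r | P i) F i g) h
    = \sum_(i <- r | P i) tsum n (F i) h.
Proof.
elim: n h => //= n IH h; rewrite exchange_big/=.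
by apply: eq_bigr => e _; exact: IH.
Qed.

Lemma tsum_cat n F g h :
  tsum n F (g ++ h) = tsum n (fun g' => F (g' ++ h)) g.
Proof.
by elim: n g => //= n IH g; apply: eq_bigr => e _; exact: (IH (e :: g)).
Qed.

Lemma tsum_ge0 n F h : (forall g, 0 <= F g) -> 0 <= tsum n F h.
Proof. by move=> F0; elim: n h => //= n IH h; apply: sumr_ge0. Qed.

Lemma tsum_ge1 F g h : (forall g, 0 <= F g) -> F (g ++ h) <= tsum (size g) F h.
Proof.
move=> F0; elim/last_ind: g h => //= g e IH h.
rewrite cat_rcons size_rcons/= (bigD1 e)//=; apply: (le_trans (IH _)).
by rewrite lerDl; apply: sumr_ge0 => e' _; exact: tsum_ge0.
Qed.

End TreeSums.

(** * Masses of the paths that hit or avoid a set *)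

Section Flow.
Context {R : numDomainType} {A : finType}.
Variable W : seq A -> R.
Hypothesis W0 : forall h, 0 <= W h.
Hypothesis WS : forall h, \sum_(e : A) W (e :: h) = W h.
Implicit Types (F G : seq A -> R) (h g : seq A) (n m : nat) (V : pred (seq A)).

(* hit V n h (avoid V n h) is the mass of the extensions of h by at most n
   (exactly n) elements that meet (do not meet) V; h itself counts. *)
Fixpoint hit V n h : R :=
  if V h then W h
  else if n is n'.+1 then \sum_(e : A) hit V n' (e :: h) else 0.

Fixpoint avoid V n h : R :=
  if V h then 0
  else if n is n'.+1 then \sum_(e : A) avoid V n' (e :: h) else W h.

Lemma hitE V n h : hit V n h =
  if V h then W h
  else if n is n'.+1 then \sum_(e : A) hit V n' (e :: h) else 0.
Proof. by case: n. Qed.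

Lemma avoidE V n h : avoid V n h =
  if V h then 0
  else if n is n'.+1 then \sum_(e : A) avoid V n' (e :: h) else W h.
Proof. by case: n. Qed.

Lemma tsumW n h : tsum n W h = W h.
Proof. by elim: n h => //= n IH h; rewrite -WS; apply: eq_bigr. Qed.

Lemma hit_avoid V n h : hit V n h + avoid V n h = W h.
Proof.
elim: n h => [|n IH] h /=; case: ifP => _; rewrite ?addr0 ?add0r//.
by rewrite -big_split/= -WS; apply: eq_bigr.
Qed.

Lemma hit_ge0 V n h : 0 <= hit V n h.
Proof. by elim: n h => [|n IH] h /=; case: ifP => // _; apply: sumr_ge0. Qed.

Lemma avoid_ge0 V n h : 0 <= avoid V n h.
Proof. by elim: n h => [|n IH] h /=; case: ifP => // _; apply: sumr_ge0. Qed.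

Lemma hit_le V n h : hit V n h <= W h.
Proof. by rewrite -(hit_avoid V n) lerDl avoid_ge0. Qed.

Lemma hit_homo V h : {homo (fun n => hit V n h) : m n / (m <= n)%N >-> m <= n}.
Proof.
move=> m n; elim: n m h => [|n IH] [|m] h //= mn; case: ifP => // _.
  by apply: sumr_ge0 => e _; exact: hit_ge0.
by apply: ler_sum => e _; exact: IH.
Qed.

Lemma avoid_homo V h :
  {homo (fun n => avoid V n h) : m n / (m <= n)%N >-> n <= m}.
Proof.
move=> m n mn; have E k : avoid V k h = W h - hit V k h.
  by rewrite -(hit_avoid V k h) addrAC subrr add0r.
by rewrite !E lerD2l lerN2; exact: hit_homo.
Qed.

(** One more step splits the weight [W g] without loss, while [F] cannot decrease along the path. *)
Lemma tsum_homo F h n m :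
  (forall e g, F g <= F (e :: g)) ->
  tsum n (fun g => W g * F g) h <= tsum (n + m) (fun g => W g * F g) h.
Proof.
move=> FS; rewrite tsum_add; apply: ler_tsum => g _.
elim: m (g ++ h) => //= m IH k; rewrite -WS mulr_suml.
apply: ler_sum => e _; apply: le_trans (IH _).
by rewrite ler_wpM2l.
Qed.

(** The suffixes of [h] are the successive pasts of the walk, so this counts the times up to the
    present, time 0 included, at which [p] holds. *)
Fixpoint csum (p : pred (seq A)) h : R :=
  (p h)%:R + (if h is _ :: h' then csum p h' else 0).

Lemma csum_cons p e h : csum p (e :: h) = (p (e :: h))%:R + csum p h.
Proof. by []. Qed.

Lemma csum_ge0 p h : 0 <= csum p h.
Proof. by elim: h => /= [|e h IH]; rewrite addr_ge0. Qed.

Lemma csum_homo p e h : csum p h <= csum p (e :: h).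
Proof. by rewrite csum_cons lerDr. Qed.

Lemma tsum_csum p n :
  tsum n (fun g => W g * csum p g) [::]
    = \sum_(0 <= j < n.+1) tsum j (fun g => W g * (p g)%:R) [::].
Proof.
elim: n => [|n IH]; first by rewrite big_nat1/= addr0.
rewrite big_nat_recr// -IH -[in RHS]addn1 -[in LHS]addn1 !tsum_add -[RHS]tsumD.
apply: eq_tsum => g _; rewrite !tsumS/= -WS mulr_suml -big_split/=.
by apply: eq_bigr => e _; rewrite mulrDr addrC.
Qed.

End Flow.

(** * Weighted paths and their escape to the right *)

(* A finite path is the list of its steps, the most recent step first. *)
Section Paths.
Context {d : nat}.
Implicit Types (h g : seq (step d)) (e : step d).

Fixpoint pos h : lattice d := if h is e :: h' then pos h' + stepv e else 0.

(** The current position is left out, so that [nvis h] counts the earlier visits, which is the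
    0-based index of the cookie used next. *)
Fixpoint trail h : seq (lattice d) :=
  if h is _ :: h' then pos h' :: trail h' else [::].

Definition nvis h : nat := count_mem (pos h) (trail h).

Lemma pos_cat g h : pos (g ++ h) = pos g + pos h.
Proof. by elim: g => [|e g IH] /=; rewrite ?add0r// IH addrAC. Qed.

Lemma trail_cat g h :
  trail (g ++ h) = [seq x + pos h | x <- trail g] ++ trail h.
Proof. by elim: g => //= e g ->; rewrite pos_cat. Qed.

Context {R : realType} (l : 'rV[R]_d).

Definition height h : R := dotp (pos h) l.

Lemma dotpD (x y : lattice d) : dotp (x + y) l = dotp x l + dotp y l.
Proof.
by rewrite -big_split; apply: eq_bigr => j _; rewrite mxE intrD mulrDl.
Qed.

Lemma dotp0 : dotp (0 : lattice d) l = 0.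
Proof. by apply: big1 => j _; rewrite mxE mul0r. Qed.

Lemma dotp_stepv e : dotp (stepv e) l = (-1) ^+ e.2 * l 0 e.1.
Proof.
rewrite /dotp (bigD1 e.1)//= big1 ?addr0 => [|j /negPf je]; rewrite stepvE.
  by rewrite eqxx mulr1; case: e.2; rewrite ?expr0 ?expr1 ?intrN.
by rewrite je mulr0 mul0r.
Qed.

Lemma ht_nil : height [::] = 0. Proof. exact: dotp0. Qed.

Lemma ht_cons e h : height (e :: h) = height h + dotp (stepv e) l.
Proof. exact: dotpD. Qed.

Lemma ht_cat g h : height (g ++ h) = height g + height h.
Proof. by rewrite /height pos_cat dotpD. Qed.

Hypothesis hl : \sum_(j < d) `|l 0 j| = 1.

Lemma dir_le1 j : `|l 0 j| <= 1.
Proof. by rewrite -hl (bigD1 j)//= lerDl sumr_ge0. Qed.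

Lemma dotp_stepv_abs e : `|dotp (stepv e) l| = `|l 0 e.1|.
Proof. by rewrite dotp_stepv normrM normrX normrN1 expr1n mul1r. Qed.

Lemma dotp_stepv_le1 e : `|dotp (stepv e) l| <= 1.
Proof. by rewrite dotp_stepv_abs dir_le1. Qed.

Lemma ht_le g : `|height g| <= (size g)%:R.
Proof.
elim: g => [|e g IH]; first by rewrite ht_nil normr0.
rewrite ht_cons -[size _]/(size g).+1 -natr1.
by apply: le_trans (ler_normD _ _) _; rewrite lerD// dotp_stepv_le1.
Qed.

End Paths.

(** * Reaching a level from a bounded distance *)

Section Weights.
Context {R : realType} {d : nat} (l : 'rV[R]_d) (kappa : R).

(* Satisfied by the path probabilities both in a fixed environment and averaged
   over the environment. *)
Record walk_weight (W : seq (step d) -> R) : Prop := WalkWeight {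
  ww_nil : W [::] = 1;
  ww_sum : forall h, \sum_(e : step d) W (e :: h) = W h;
  ww_ell : forall e h, kappa * W h <= W (e :: h);
  ww_drift : forall h, 0 <= \sum_(e : step d) W (e :: h) * dotp (stepv e) l }.

Hypothesis hd : (2 <= d)%N.
Hypothesis hl : \sum_(j < d) `|l 0 j| = 1.
Hypothesis hk0 : 0 < kappa.
Variable W : seq (step d) -> R.
Hypothesis HW : walk_weight W.

Local Notation ht := (height l).

Lemma ww_gt0 h : 0 < W h.
Proof.
elim: h => [|e h IH]; first by rewrite (ww_nil HW).
by apply: lt_le_trans (ww_ell HW e h); rewrite mulr_gt0.
Qed.

Lemma ww_ge0 h : 0 <= W h. Proof. exact/ltW/ww_gt0. Qed.

Lemma ww_ell_cat g h : kappa ^+ size g * W h <= W (g ++ h).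
Proof.
elim: g => [|e g IH] /=; first by rewrite mul1r.
apply: le_trans (ww_ell HW e _); rewrite exprS -mulrA.
by rewrite ler_wpM2l// ltW.
Qed.

Lemma large_coordinate : exists j, d%:R^-1 <= `|l 0 j|.
Proof.
have d0 : 0 < d%:R :> R by rewrite ltr0n; lia.
apply: contrapT => /forallNP H.
suff : \sum_(j < d) `|l 0 j| < \sum_(j < d) d%:R^-1.
  by rewrite hl sumr_const card_ord -[X in _ < X]mulr_natl mulfV ?ltxx ?gt_eqF.
apply: ltr_sum => [|j _]; last by have /negP := H j; rewrite -ltNge.
by apply/hasP; exists (Ordinal (ltnW hd)); rewrite ?mem_index_enum.
Qed.

(** A step along a coordinate of [l] of size at least [1 / d] has conditional weight at least
    [kappa]; its term alone suffices. *)
Lemma second_moment h :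
  kappa / d%:R ^+ 2 * W h <= \sum_(e : step d) W (e :: h) * dotp (stepv e) l ^+ 2.
Proof.
have [j hj] := large_coordinate.
rewrite (bigD1 (j, false))//=.
apply: le_trans (_ : W ((j, false) :: h) * dotp (stepv (j, false)) l ^+ 2 <= _).
  rewrite mulrAC; apply: ler_pM; last 2 first.
  - exact: ww_ell.
  - rewrite -[leRHS]real_normK ?num_real// dotp_stepv_abs/= -exprVn.
    by rewrite lerXn2r ?nnegrE// invr_ge0.
  - by rewrite mulr_ge0 ?ww_ge0// ltW.
  - by rewrite invr_ge0 exprn_ge0.
rewrite lerDl; apply: sumr_ge0 => e _.
by rewrite mulr_ge0 ?ww_ge0 ?sqr_ge0.
Qed.

(** With [s] and [t] the roots of [z] and [z + u], multiplication by [18 * s ^ 3] turns the claim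
    into [0 <= (t - s) ^ 2 * (9 * s ^ 2 - (t + s) ^ 2)]. This holds because [t <= 2 * s], that is,
    [z + u <= 4 * z]. *)
Lemma sqrt_step (z u : R) : 2 <= z -> `|u| <= 1 ->
  Num.sqrt (z + u) <=
    Num.sqrt z + u / (2 * Num.sqrt z) - u ^+ 2 / (18 * Num.sqrt z ^+ 3).
Proof.
move=> z2; rewrite ler_norml => /andP[u1 u2].
set s := Num.sqrt z; set t := Num.sqrt (z + u).
have s0 : 0 < s by rewrite sqrtr_gt0; lra.
have t0 : 0 < t by rewrite sqrtr_gt0; lra.
have ss : s ^+ 2 = z by rewrite sqr_sqrtr//; lra.
have tt : t ^+ 2 = z + u by rewrite sqr_sqrtr//; lra.
have ts : t <= 2 * s.
  rewrite -(@ler_pXn2r _ 2) ?nnegrE//; last 2 first; [lra|lra|].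
  by rewrite exprMn ss tt; lra.
have -> : u = (t - s) * (t + s).
  by rewrite -subr_sqr tt ss addrC addKr.
have s3 : 0 < 18 * s ^+ 3 by rewrite mulr_gt0// exprn_gt0.
rewrite -subr_ge0 -(pmulr_rge0 _ s3).
have -> : 18 * s ^+ 3 * (s + (t - s) * (t + s) / (2 * s) -
    ((t - s) * (t + s)) ^+ 2 / (18 * s ^+ 3) - t) =
    (t - s) ^+ 2 * (9 * s ^+ 2 - (t + s) ^+ 2).
  by field; rewrite gt_eqF.
rewrite mulr_ge0 ?sqr_ge0// subr_ge0.
have -> : 9 * s ^+ 2 = (3 * s) ^+ 2 by ring.
by apply: lerXn2r; rewrite ?nnegrE; lra.
Qed.

(* Lyapunov function: with Y = b - ht > 0 the distance to the level b,
   sqrt (Y + 2) decreases on average by at least c / (Y + 2)^(3/2). *)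
Section Lyapunov.
Variable b : R.
Let V (g : seq (step d)) := b <= ht g.
Let f g := Num.sqrt (b - ht g + 2).
Let c := kappa / d%:R ^+ 2 / 18.

(** The mean of [F] at time [n] for the walk killed on reaching level [b]. *)
Fixpoint alive (F : seq (step d) -> R) n h : R :=
  if V h then 0
  else if n is n'.+1 then \sum_(e : step d) alive F n' (e :: h) else W h * F h.

Let c_gt0 : 0 < c.
Proof. by rewrite !divr_gt0 ?exprn_gt0// ltr0n; lia. Qed.

Let f_ge0 g : 0 <= f g. Proof. exact: sqrtr_ge0. Qed.

(** In the expansion of [sqrt_step] the first-order term has the right sign by [ww_drift], and
    [second_moment] bounds the second-order term. The shift by 2 in [f] ensures the hypothesis
    [2 <= z]. *)
Lemma lyapunov_step h : ~~ V h ->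
  \sum_(e : step d) W (e :: h) * f (e :: h) <= W h * f h - W h * (c / f h ^+ 3).
Proof.
move=> nV; have Y0 : 2 <= b - ht h + 2 by move: nV; rewrite /V -ltNge; lra.
have f0 : 0 < f h by rewrite /f sqrtr_gt0; lra.
pose u e := - dotp (stepv e) l.
apply: le_trans (_ : \sum_(e : step d) W (e :: h) *
    (f h + u e / (2 * f h) - u e ^+ 2 / (18 * f h ^+ 3)) <= _).
  apply: ler_sum => e _; rewrite ler_wpM2l ?ww_ge0//.
  rewrite [X in X <= _](_ : _ = Num.sqrt ((b - ht h + 2) + u e)).
    by apply: sqrt_step => //; rewrite normrN dotp_stepv_le1.
  by rewrite /f ht_cons /u; congr Num.sqrt; ring.
have -> : \sum_(e : step d) W (e :: h) *
    (f h + u e / (2 * f h) - u e ^+ 2 / (18 * f h ^+ 3)) =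
  W h * f h - (\sum_(e : step d) W (e :: h) * dotp (stepv e) l) / (2 * f h)
  - (\sum_(e : step d) W (e :: h) * dotp (stepv e) l ^+ 2) / (18 * f h ^+ 3).
  rewrite -[in RHS](ww_sum HW) !mulr_suml -!sumrB.
  by apply: eq_bigr => e _; rewrite /u; ring.
have P1 : 0 <= (\sum_(e : step d) W (e :: h) * dotp (stepv e) l) / (2 * f h).
  by rewrite divr_ge0 ?(ww_drift HW)// mulr_ge0// ltW.
have P2 : W h * (c / f h ^+ 3) <= (\sum_(e : step d) W (e :: h) *
    dotp (stepv e) l ^+ 2) / (18 * f h ^+ 3).
  have -> : W h * (c / f h ^+ 3) = kappa / d%:R ^+ 2 * W h / (18 * f h ^+ 3).
    have E (w a F : R) : F != 0 -> w * (a / 18 / F) = a * w / (18 * F).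
      by move=> F0; field.
    by rewrite /c E// gt_eqF ?exprn_gt0.
  rewrite ler_wpM2r ?second_moment// invr_ge0 mulr_ge0// exprn_ge0//.
lra.
Qed.

Lemma alive_f n h : alive f n h <= W h * f h.
Proof.
elim: n h => [|n IH] h /=; case: ifPn => [_|nV] //; rewrite ?mulr_ge0 ?ww_ge0//.
apply: le_trans (_ : \sum_(e : step d) W (e :: h) * f (e :: h) <= _).
  by apply: ler_sum => e _; exact: IH.
apply: (le_trans (lyapunov_step nV)); rewrite gerBl.
by rewrite mulr_ge0 ?ww_ge0// divr_ge0 ?exprn_ge0// ltW.
Qed.

(** The mean losses of the nonnegative supermartingale [f] telescope, so that they add up to at most
    its initial value. *)
Lemma alive_c n h :
  \sum_(j < n) alive (fun g => c / f g ^+ 3) j h <= W h * f h.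
Proof.
elim: n h => [|n IH] h; first by rewrite big_ord0 mulr_ge0 ?ww_ge0.
have [hV|nV] := boolP (V h).
  by rewrite big1 ?mulr_ge0 ?ww_ge0// => j _; case: (nat_of_ord j) => /=; rewrite hV.
rewrite big_ord_recl/= (negbTE nV).
rewrite (eq_bigr (fun j : 'I_n => \sum_(e : step d)
  alive (fun g => c / f g ^+ 3) j (e :: h))); last first.
  by [].
rewrite exchange_big/=.
have := lyapunov_step nV; set S := \sum_e _ => HS.
suff : \sum_(e : step d) \sum_(j < n) alive (fun g => c / f g ^+ 3) j (e :: h) <= S.
  by move: HS; lra.
by apply: ler_sum => e _; exact: IH.
Qed.

(** A path still alive either has [f >= N], which is rare by [alive_f] and Markov's inequality, or
    loses at least [c / N ^ 3] on average in the next step, which by [alive_c] cannot last. As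
    [avoid] decreases in time, its value at [n] is at most its average over the times before [n]. *)
Lemma avoid_level_bound (N : R) n h : 0 < N -> ~~ V h ->
  n%:R * avoid W V n h <= W h * f h * (n%:R / N + N ^+ 3 / c).
Proof.
move=> N0 nV.
have key j g : avoid W V j g <=
    alive f j g / N + alive (fun g => c / f g ^+ 3) j g * (N ^+ 3 / c).
  elim: j g => [|j IH] g /=; case: ifPn => [_|nVg]; rewrite ?mul0r ?addr0//.
    rewrite -!(mulrA (W g)) -mulrDr -[leLHS]mulr1 ler_wpM2l ?ww_ge0//.
    have f0 : 0 < f g by rewrite sqrtr_gt0; move: nVg; rewrite /V -ltNge; lra.
    have T1 : 0 <= f g / N by rewrite divr_ge0// ltW.
    have T2 : c / f g ^+ 3 * (N ^+ 3 / c) = (N / f g) ^+ 3.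
      by field; rewrite !gt_eqF.
    have T3 : 0 <= (N / f g) ^+ 3 by rewrite exprn_ge0// divr_ge0// ltW.
    rewrite T2; have [le|/ltW lt] := leP N (f g).
      by apply: ler_wpDr => //; rewrite ler_pdivlMr// mul1r.
    by apply: ler_wpDl => //; rewrite exprn_ege1// ler_pdivlMr// mul1r.
  by rewrite mulr_suml mulr_suml -big_split; apply: ler_sum => e _; exact: IH.
apply: le_trans (_ : \sum_(j < n) avoid W V j h <= _).
  have -> : n%:R * avoid W V n h = \sum_(j < n) avoid W V n h.
    by rewrite sumr_const card_ord mulr_natl.
  apply: ler_sum => j _.
  by apply: (avoid_homo ww_ge0 (ww_sum HW)); exact/ltnW/ltn_ord.
apply: le_trans; first by apply: ler_sum => j _; exact: key.
rewrite big_split/= -!mulr_suml mulrDr lerD//.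
  rewrite mulrA; apply: ler_wpM2r; first by rewrite invr_ge0 ltW.
  have -> : W h * f h * n%:R = \sum_(j < n) W h * f h.
    by rewrite sumr_const card_ord mulr_natr.
  by apply: ler_sum => j _; exact: alive_f.
by rewrite ler_wpM2r ?alive_c// divr_ge0 ?exprn_ge0 ?ltW.
Qed.

End Lyapunov.

Lemma avoid_level_small (a del : R) : 0 < del -> exists N, forall b h n,
  (N <= n)%N -> b - a <= ht h ->
  avoid W (fun g => b <= ht g) n h <= del * W h.
Proof.
move=> del0; set M := Num.sqrt (`|a| + 2) + 1.
have M0 : 0 < M by rewrite ltr_wpDl ?sqrtr_ge0.
set c := kappa / d%:R ^+ 2 / 18.
have c0 : 0 < c by rewrite !divr_gt0 ?exprn_gt0// ltr0n; lia.
(* After division by [n], this [N] makes the first term of [avoid_level_bound] at most [del / 2],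
   and the choice of [n0] does the same for the second. *)
pose N := 2 * M / del; have N0 : 0 < N by rewrite !divr_gt0 ?mulr_gt0.
have [n0 Hn0] : exists n0 : nat, 2 * M * (N ^+ 3 / c) / del < n0%:R.
  by exists (Num.truncn (2 * M * (N ^+ 3 / c) / del)).+1; rewrite truncnS_gt.
exists n0.+1 => b h n n0n bh.
have [hV|nV] := boolP (b <= ht h).
  by rewrite avoidE hV mulr_ge0 ?ww_ge0// ltW.
have n_gt0 : 0 < n%:R :> R by rewrite ltr0n; lia.
have fM : Num.sqrt (b - ht h + 2) <= M.
  apply: le_trans (_ : Num.sqrt (`|a| + 2) <= _); last by rewrite lerDl.
  apply: ler_wsqrtr; have := ler_norm a; move: bh; lra.
have E1 : M * (n%:R / N) = n%:R * (del / 2) by rewrite /N; field; rewrite !gt_eqF.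
have E2 : M * (N ^+ 3 / c) <= n%:R * (del / 2).
  move: Hn0; rewrite ltr_pdivrMr// => Hn0.
  have : n0%:R * del <= n%:R * del.
    by apply: ler_wpM2r; [exact: ltW|rewrite ler_nat ltnW].
  by move: Hn0; rewrite -mulrA; lra.
rewrite -(ler_pM2l n_gt0); apply: (le_trans (avoid_level_bound n N0 nV)).
rewrite -mulrA; apply: le_trans (_ : W h * (M * (n%:R / N + N ^+ 3 / c)) <= _).
  rewrite ler_wpM2l ?ww_ge0// ler_wpM2r// addr_ge0//.
    by rewrite divr_ge0// ltW.
  by rewrite divr_ge0 ?exprn_ge0// ltW.
have -> : n%:R * (del * W h) = W h * (n%:R * (del / 2) + n%:R * (del / 2)) by field.
by rewrite ler_wpM2l ?ww_ge0// mulrDr E1 lerD2l.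
Qed.

End Weights.

(** * Many points in a slab *)

Section Points.
Context {R : realType} {d : nat} (l : 'rV[R]_d).
Implicit Types (h g : seq (step d)) (x : lattice d).
Local Notation ht := (height l).

Definition visited h : seq (lattice d) := pos h :: trail h.

Definition fresh h := pos h \notin trail h.

Definition slab (a : R) x := a <= dotp x l < a + 1.

Definition below (b : R) h := all (fun x => dotp x l < b) (visited h).

Definition is_record h := all (fun x => dotp x l < ht h) (trail h).

Definition npts (a : R) h : R := csum (fun g => fresh g && slab a (pos g)) h.

Lemma visited_cons e h : visited (e :: h) = pos (e :: h) :: visited h.
Proof. by []. Qed.

Lemma sub_visited g h : {subset visited h <= visited (g ++ h)}.
Proof.
move=> x; elim: g => //= e g IH /IH xg.
by rewrite visited_cons inE xg orbT.
Qed.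

(** Every visited site is fresh at exactly one time, that of its first visit. *)
Lemma csum_undup (P : pred (lattice d)) h :
  csum (fun g => fresh g && P (pos g)) h
    = (size (undup (seq.filter P (visited h))))%:R :> R.
Proof.
elim: h => [|e h IH]; first by rewrite /= /fresh/= addr0; case: ifP.
rewrite csum_cons IH visited_cons.
rewrite [fresh _]/(pos (e :: h) \notin visited h).
have -> x s : seq.filter P (x :: s) =
    if P x then x :: seq.filter P s else seq.filter P s by [].
have [Px|nPx] := boolP (P (pos (e :: h))); last by rewrite andbF add0r.
rewrite andbT.
have -> x s : undup (x :: s) =
    if x \in s then undup s else x :: undup s :> seq (lattice d) by [].
rewrite mem_filter Px andTb; case: (_ \in _) => /=.
  by rewrite add0r.
by rewrite [RHS]mulrS.
Qed.

Lemma nptsE a h : npts a h = (size (undup (seq.filter (slab a) (visited h))))%:R.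
Proof. exact: csum_undup. Qed.

Lemma npts_ge0 a h : 0 <= npts a h. Proof. exact: csum_ge0. Qed.

Lemma npts_homo a e h : npts a h <= npts a (e :: h).
Proof. exact: csum_homo. Qed.

Lemma npts_cat a g h : npts a h <= npts a (g ++ h).
Proof. by elim: g => //= e g IH; exact: le_trans IH (npts_homo _ _ _). Qed.

Hypothesis hd : (2 <= d)%N.
Hypothesis hl : \sum_(j < d) `|l 0 j| = 1.

(* Two coordinates suffice to move for ever inside the slab: step up along the
   first or down along the second one.  The function lam below increases by one
   at each such step, so that the points are distinct. *)
Lemma slab_extension a g q : slab a (pos g) -> exists h s,
  [/\ size h = q, size s = q, uniq s, all (slab a) s &
      {subset s <= visited (h ++ g)}].
Proof.
move=> sg; pose j0 := Ordinal (ltnW hd); pose j1 := Ordinal hd.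
(* The signs are chosen such that [(j0, b0)] never lowers the height and [(j1, b1)] never raises
   it. *)
pose b0 := l 0 j0 < 0; pose b1 := ~~ (l 0 j1 < 0).
pose lam (x : lattice d) : int := (-1) ^+ b0 * x 0 j0 + (-1) ^+ b1 * x 0 j1.
have upE : dotp (stepv (j0, b0)) l = `|l 0 j0|.
  rewrite dotp_stepv/= /b0; case: ltP => l0; rewrite ?expr1 ?expr0.
    by rewrite mulN1r ltr0_norm.
  by rewrite mul1r ger0_norm.
have dnE : dotp (stepv (j1, b1)) l = - `|l 0 j1|.
  rewrite dotp_stepv/= /b1; case: ltP => l0; rewrite ?expr1 ?expr0.
    by rewrite mul1r ltr0_norm// opprK.
  by rewrite mulN1r ger0_norm.
have j01 : (j0 == j1) = false by [].
have j10 : (j1 == j0) = false by [].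
have addE x e j : (x + stepv e) 0 j = x 0 j + (-1) ^+ e.2 * (j == e.1)%:R.
  by rewrite mxE stepvE.
have sgn b : (-1) ^+ b * (-1) ^+ b = 1 :> int by rewrite -expr2 sqrr_sign.
have lamup x : lam (x + stepv (j0, b0)) = lam x + 1.
  rewrite /lam !addE [(_, _).1]/= [(_, _).2]/= j10 eqxx mulr0 addr0 mulr1.
  by rewrite mulrDr sgn addrAC.
have lamdn x : lam (x + stepv (j1, b1)) = lam x + 1.
  rewrite /lam !addE [(_, _).1]/= [(_, _).2]/= j01 eqxx mulr0 addr0 mulr1.
  by rewrite mulrDr sgn addrA.
have l01 : `|l 0 j0| + `|l 0 j1| <= 1.
  rewrite -hl (bigD1 j0)//= (bigD1 j1)//= addrA lerDl.
  by apply: sumr_ge0.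
suff [h [s [? ? ? ? []]]] : exists h s, [/\ size h = q, size s = q, uniq s,
    all (slab a) s & [/\ slab a (pos (h ++ g)), {subset s <= visited (h ++ g)} &
    forall x, x \in s -> lam x <= lam (pos (h ++ g))]].
  by exists h, s.
elim: q => [|q [h [s [sh ss us as_ [shg sub lams]]]]].
  by exists [::], [::]; split.
have [e [se lame]] : exists e, slab a (pos (h ++ g) + stepv e) /\
    lam (pos (h ++ g) + stepv e) = lam (pos (h ++ g)) + 1.
  move: shg; rewrite /slab => /andP[s1 s2].
  have := normr_ge0 (l 0 j0); have := normr_ge0 (l 0 j1) => n1 n0.
  (* If the downward step would leave the slab, the upward one stays inside, since the two heights
     add up to at most 1 by [l01]. *)
  have [le|lt] := leP a (dotp (pos (h ++ g)) l - `|l 0 j1|).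
    by exists (j1, b1); rewrite dotpD dnE lamdn; split=> //; apply/andP; split; lra.
  by exists (j0, b0); rewrite dotpD upE lamup; split=> //; apply/andP; split; lra.
exists (e :: h), (pos (h ++ g) + stepv e :: s); split=> //=.
- by rewrite sh.
- by rewrite ss.
- rewrite us andbT; by apply/negP => /lams; rewrite lame gerDl.
- by rewrite se.
- split=> // x; rewrite in_cons => /predU1P[->|xs].
  - exact: mem_head.
  - by rewrite visited_cons in_cons (sub _ xs) orbT.
  - by [].
  by rewrite lame; apply: le_trans (lams _ xs) _; rewrite lerDl.
Qed.

(** Of the [q] distinct points of [slab_extension] at least one is new, since fewer than [q] points
    of the slab have been visited. *)
Lemma new_point_extension a g q : slab a (pos g) -> npts a g < q%:R ->
  exists2 h, size h = q & npts a g + 1 <= npts a (h ++ g).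
Proof.
move=> sg; rewrite !nptsE ltr_nat => lt.
have [h [s [sh ss us as_ sub]]] := slab_extension q sg.
exists h => //; rewrite nptsE natr1 ler_nat.
have /hasP[x xs xg] : has (fun x => x \notin visited g) s.
  rewrite has_predC; apply/negP => /allP H; move: lt; apply/negP.
  rewrite -leqNgt -ss; apply: uniq_leq_size => // y ys.
  by rewrite mem_undup mem_filter (allP as_ _ ys) (H _ ys).
rewrite -[X in (X <= _)%N]/(size (x :: undup (seq.filter (slab a) (visited g)))).
apply: uniq_leq_size.
  rewrite cons_uniq undup_uniq mem_undup (mem_filter (slab a)) (negbTE xg).
  by rewrite andbF.
move=> y; rewrite in_cons !mem_undup !mem_filter => /predU1P[->|/andP[-> /sub_visited ->//]].
by rewrite (allP as_ _ xs) sub.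
Qed.

End Points.

(** * Mean number of sites in a slab when records are undercut *)

Section Blocks.
Context {R : realType} {d : nat} (l : 'rV[R]_d) (kappa : R).
Hypothesis hd : (2 <= d)%N.
Hypothesis hl : \sum_(j < d) `|l 0 j| = 1.
Hypothesis hk0 : 0 < kappa.
Variable W : seq (step d) -> R.
Hypothesis HW : walk_weight l kappa W.
Local Notation ht := (height l).
Implicit Types (h g : seq (step d)).

Let W_ge0 := ww_ge0 hk0 HW.
Let W_sum := ww_sum HW.

(** Counting time from [h], undercutting is allowed before time [t] and forbidden from [t] to
    [t + n]. *)
Definition escapes t n h := tsum t (avoid W (fun g => ht g < ht h) n) h.

Definition wnpts a g := W g * npts l a g.

(** The extension from [new_point_extension] has conditional weight at least [kappa ^ q]; on the
    other extensions the count does not drop. *)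
Lemma wnpts_new a g q : slab l a (pos g) -> npts l a g < q%:R ->
  wnpts a g + kappa ^+ q * W g <= tsum q (wnpts a) g.
Proof.
move=> sg lt; have [h sh Hh] := new_point_extension hd hl sg lt.
have -> : tsum q (wnpts a) g =
    npts l a g * W g + tsum q (fun g' => W g' * (npts l a g' - npts l a g)) g.
  rewrite -[in npts l a g * W g](tsumW W_sum q) -tsumZ -tsumD.
  by apply: eq_tsum => g' _; rewrite /wnpts; ring.
rewrite /wnpts [W g * _]mulrC lerD2l.
apply: le_trans (_ : tsum q (fun g' => if (npts l a g <= npts l a g')
   then W g' * (npts l a g' - npts l a g) else 0) g <= _); last first.
  apply: ler_tsum => g' _; case: ifP => // /negbT; rewrite npts_cat//.
rewrite -sh; apply: le_trans (tsum_ge1 _ _ _); last first.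
  by move=> g'; case: ifP => // le; rewrite mulr_ge0// subr_ge0.
rewrite npts_cat; apply: le_trans (ww_ell_cat hk0 HW _ _) _.
by rewrite ler_peMr// lerBrDl.
Qed.

Let few (a r : R) g := slab l a (pos g) && (npts l a g < r)%R.

(** [wnpts_new] is applied at the first time the path is in [few]; before and after, the count never
    drops. *)
Lemma wnpts_hit a q n g :
  wnpts a g + kappa ^+ q * hit W (few a q%:R) n g <= tsum (n + q) (wnpts a) g.
Proof.
have homo m g' : wnpts a g' <= tsum m (wnpts a) g'.
  by have := @tsum_homo _ _ W W_ge0 W_sum (npts l a) g' 0 m (npts_homo l a).
elim: n g => [|n IH] g; rewrite hitE; case: ifPn => [/andP[sg lt]|_].
- exact: wnpts_new.
- by rewrite mulr0 addr0.
- rewrite addnC tsum_add; apply: (le_trans (wnpts_new sg lt)).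
  by apply: ler_tsum => g' _; exact: homo.
- rewrite addSn tsumS mulr_sumr.
  apply: le_trans (_ : \sum_e (wnpts a (e :: g) +
    kappa ^+ q * hit W (few a q%:R) n (e :: g)) <= _); last by apply: ler_sum.
  rewrite big_split/= lerD2r /wnpts -W_sum mulr_suml; apply: ler_sum => e _.
  by rewrite ler_wpM2l// npts_homo.
Qed.

Let many (a r : R) g : R := W g * (r <= npts l a g)%R%:R.

Lemma many_homo a r m g : many a r g <= tsum m (many a r) g.
Proof.
have := @tsum_homo _ _ W W_ge0 W_sum (fun g => (r <= npts l a g)%R%:R) g 0 m.
apply => e g'; rewrite ler_nat; case: leP => //= rg.
by rewrite (le_trans rg)// npts_homo.
Qed.

(** A path in the slab but not in [few] has at least [r] points already and keeps them, so [many]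
    accounts for it. *)
Lemma hit_few a r n g :
  hit W (fun g => slab l a (pos g)) n g - tsum n (many a r) g
    <= hit W (few a r) n g.
Proof.
elim: n g => [|n IH] g; rewrite hitE [in leRHS]hitE /few.
  have M0 : 0 <= many a r g by rewrite mulr_ge0.
  case: ifP => /= sg; last by rewrite sub0r oppr_le0.
  by case: ltP => rg; rewrite ?gerBl// /many rg mulr1 subrr.
case: ifP => /= sg; last first.
  rewrite -sumrB; apply: ler_sum => e _; exact: IH.
case: ltP => /= rg.
  by rewrite gerBl; apply: (@tsum_ge0 _ _ n.+1) => g'; rewrite mulr_ge0.
apply: le_trans (_ : 0 <= _); last by apply: sumr_ge0 => e _; exact: hit_ge0.
rewrite subr_le0; apply: le_trans (many_homo a r n.+1 g).
by rewrite /many rg mulr1.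
Qed.

(** Once below [ht h], the walk climbs back to [ht h] with probability at least 3/4 by the first
    hypothesis, and it cannot jump over the slab, because a step rises by at most 1. The margin [n]
    keeps it at or above [ht h - A] during the [n] steps in which it may go below [ht h]. *)
Lemma hit_slab A N n h g :
  (forall b h n, (N <= n)%N -> b - A <= ht h ->
     avoid W (fun g => b <= ht g) n h <= 1 / 4 * W h) ->
  ht h - A + n%:R <= ht g ->
  3 / 4 * hit W (fun g => ht g < ht h) n g
    <= hit W (fun g => slab l (ht h) (pos g)) (n + N) g.
Proof.
move=> HN.
have enter m g' : ht g' < ht h ->
    W g' - avoid W (fun g => ht h <= ht g) m g'
      <= hit W (fun g => slab l (ht h) (pos g)) m g'.
  elim: m g' => [|m IH] g' lt;
    have nle : (ht h <= dotp (pos g') l) = false by exact: lt_geF.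
    by rewrite avoidE hitE /slab /height nle subrr.
  rewrite avoidE hitE /slab /height nle.
  rewrite -W_sum -sumrB; apply: ler_sum => e _.
  have [le|lt'] := leP (ht h) (ht (e :: g')); last exact: IH.
  have le' : dotp (pos h) l <= dotp (pos (e :: g')) l by [].
  rewrite avoidE hitE le' subr0 andTb; case: ifP => // /negP[].
  rewrite -[X in X < _]/(ht (e :: g')) -[X in _ < X + _]/(ht h) ht_cons.
  have := dotp_stepv_le1 hl e; rewrite ler_norml => /andP[_]; move: lt; lra.
elim: n g => [|n IH] g Hg; have [lt|ge] := ltP (ht g) (ht h).
- rewrite hitE lt; apply: le_trans (enter _ _ lt).
  by have := HN (ht h) g N (leqnn _); move: Hg; rewrite addr0; lra.
- by rewrite hitE ltNge ge/= mulr0 hit_ge0.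
- rewrite [X in _ * X]hitE lt; apply: le_trans (enter _ _ lt).
  have := HN (ht h) g (n.+1 + N)%N (leq_addl _ _).
  have : 0 <= n.+1%:R :> R by []. move: Hg; lra.
- rewrite [X in _ * X]hitE ltNge ge/=; case: ifP => _.
    rewrite -W_sum mulr_sumr; apply: ler_sum => e _.
    have := hit_le W_ge0 W_sum (fun g => ht g < ht h) n (e :: g).
    have := W_ge0 (e :: g); lra.
  rewrite mulr_sumr; apply: ler_sum => e _; apply: IH.
  rewrite ht_cons; have := dotp_stepv_le1 hl e; rewrite ler_norml => /andP[+ _].
  by move: Hg; rewrite -natr1; lra.
Qed.

Hypothesis no_escape : forall t, exists n, forall h,
  is_record l h -> escapes t n h < W h / 4.

(** With probability at least 3/4 the walk is below the record at some time from [t] to [t + n], and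
    then it returns to the slab with probability at least 3/4; the product 9/16 exceeds 1/2. Until
    then it is at most [t + n] below the record, the distance given to [avoid_level_small]. *)
Lemma slab_revisited t : exists n, forall h, is_record l h ->
  W h / 2 <= tsum t (hit W (fun g => slab l (ht h) (pos g)) n) h.
Proof.
have [n Hn] := no_escape t.
have [N HN] : exists N, forall b h m, (N <= m)%N -> b - (t + n)%:R <= ht h ->
    avoid W (fun g => b <= ht g) m h <= 1 / 4 * W h.
  by apply: (avoid_level_small hd hl hk0 HW) => //; rewrite divr_gt0.
exists (n + N)%N => h /Hn; rewrite /escapes => Hh.
apply: le_trans (_ : tsum t (fun g => 3 / 4 * hit W (fun g => ht g < ht h) n g) h <= _).
  have := W_ge0 h; rewrite tsumZ; move: Hh.
  rewrite -[in W h / 4](tsumW W_sum t) -[in W h / 2](tsumW W_sum t).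
  rewrite -[in 0 <= _](tsumW W_sum t).
  have -> : tsum t W h = tsum t (hit W (fun g => ht g < ht h) n) h +
      tsum t (avoid W (fun g => ht g < ht h) n) h.
    by rewrite -tsumD; apply: eq_tsum => g _; rewrite hit_avoid.
  lra.
apply: ler_tsum => g sg; apply: hit_slab HN _.
rewrite ht_cat natrD; have := ht_le hl g; rewrite sg ler_norml => /andP[+ _]; lra.
Qed.

(** The blocks follow each other: the length [L] of the first [J] blocks is the time after which the
    next one asks for a return to the slab. Each block adds on average [kappa ^ q] times the mass
    that returns with fewer than [q] points. *)
Lemma many_blocks q J : exists L, forall h, is_record l h ->
  J%:R * kappa ^+ q * (W h / 2 - tsum L (many (ht h) q%:R) h)
    <= tsum L (wnpts (ht h)) h.
Proof.
elim: J => [|J [L HL]].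
  by exists 0%N => h _; rewrite !mul0r /= mulr_ge0 ?npts_ge0.
have [n Hn] := slab_revisited L.
exists (L + (n + q))%N => h rh; rewrite !tsum_add.
set a := ht h.
apply: le_trans (_ : tsum L (fun g => wnpts a g +
    kappa ^+ q * hit W (few a q%:R) n g) h <= _); last first.
  by apply: ler_tsum => g _; exact: wnpts_hit.
rewrite tsumD tsumZ -natr1 2!mulrDl mul1r; apply: lerD.
  apply: le_trans (HL _ rh); apply: ler_wpM2l.
    by rewrite mulr_ge0 ?exprn_ge0// ltW.
  by rewrite lerD2l lerN2; apply: ler_tsum => g _; exact: many_homo.
apply: ler_wpM2l; first by rewrite exprn_ge0// ltW.
apply: le_trans (_ : tsum L (fun g => hit W (fun g => slab l a (pos g)) n g -
   tsum n (many a q%:R) g) h <= _); last first.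
  by apply: ler_tsum => g _; exact: hit_few.
rewrite tsumB; apply: lerB; first exact: Hn.
apply: ler_tsum => g _; rewrite tsum_add.
by apply: ler_tsum => g' _; exact: many_homo.
Qed.

Lemma many_points (B : nat) : exists L, forall h, is_record l h ->
  B%:R * W h <= tsum L (wnpts (ht h)) h.
Proof.
(* If [q] points occur with probability at least 1/4, their mean number is at least [B]. Otherwise
   each block gains at least [kappa ^ q / 4], and [J] such gains reach [B]. *)
pose q := (4 * B)%N.
have kq : 0 < kappa ^+ q by rewrite exprn_gt0.
pose J := (Num.truncn (4 * B%:R / kappa ^+ q)).+1.
have HJ : 4 * B%:R <= J%:R * kappa ^+ q.
  by rewrite -ler_pdivrMr// ltW// truncnS_gt.
have [L HL] := many_blocks q J; exists L => h rh.
have := HL _ rh; set y := tsum L (many _ _) h; set z := tsum L _ h => H1.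
have H2 : q%:R * y <= z.
  rewrite /y /z -tsumZ; apply: ler_tsum => g _.
  rewrite /many /wnpts mulrCA ler_wpM2l//.
  have [le|_] := leP q%:R (npts l (ht h) (g ++ h)).
    by rewrite mulr1.
  by rewrite mulr0 npts_ge0.
have W0 := W_ge0 h; rewrite natrM in H2.
have [le|lt] := leP (W h / 4) y.
  apply: le_trans H2; rewrite -mulrA mulrCA ler_wpM2l//; lra.
apply: le_trans H1; apply: le_trans (_ : 4 * B%:R * (W h / 4) <= _); first by lra.
apply: le_trans (_ : J%:R * kappa ^+ q * (W h / 4) <= _).
  by apply: ler_wpM2r => //; lra.
by apply: ler_wpM2l; [rewrite mulr_ge0 ?ltW|lra].
Qed.

End Blocks.

(** * Escape from a record with positive probability *)

Section Escape.
Context {R : realType} {d : nat} (l : 'rV[R]_d) (kappa : R).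
Hypothesis hd : (2 <= d)%N.
Hypothesis hl : \sum_(j < d) `|l 0 j| = 1.
Hypothesis hk0 : 0 < kappa.
Variable W : seq (step d) -> R.
Hypothesis HW : walk_weight l kappa W.
Local Notation ht := (height l).
Implicit Types (h g : seq (step d)).

Let W_ge0 := ww_ge0 hk0 HW.
Let W_sum := ww_sum HW.

Lemma below_cons b e h : below l b (e :: h) = (ht (e :: h) < b) && below l b h.
Proof. by []. Qed.

Lemma belowW b b' h : b <= b' -> below l b h -> below l b' h.
Proof. by move=> bb /allP H; apply/allP => x /H /lt_le_trans; apply. Qed.

Lemma below_cat b g h : below l b h -> below l (b + (size g)%:R) (g ++ h).
Proof.
move=> bh; elim: g => [|e g IH]; first by rewrite addr0.
rewrite cat_cons below_cons ht_cons [size _]/= -natr1.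
have := dotp_stepv_le1 hl e; rewrite ler_norml => /andP[_ se].
have /andP[lt _] := IH; rewrite -/(ht _) in lt; apply/andP; split.
  by move: lt; rewrite /height; lra.
by apply: belowW IH; lra.
Qed.

(** Long enough to contain every slab [[a, a + 1)] with [i <= a < i + 1], while no height lies in
    more than two of these intervals. *)
Let near_level (i : nat) (y : R) := i%:R <= y < i.+2%:R.

Lemma sum_near_level K y : \sum_(i < K) (near_level i y)%:R <= 2 :> R.
Proof.
suff -> : \sum_(i < K) (near_level i y)%:R =
    (0%:R <= y)%R%:R + (1%:R <= y)%R%:R - (K%:R <= y)%R%:R - (K.+1%:R <= y)%R%:R :> R.
  by do 4 case: (_ <= y)%R; rewrite /=; lra.
elim: K => [|K IH]; first by rewrite big_ord0; ring.
rewrite big_ord_recr/= {}IH.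
have -> : (near_level K y)%:R = (K%:R <= y)%R%:R - (K.+2%:R <= y)%R%:R :> R.
  rewrite /near_level ltNge; have [le|lt] := leP K%:R y.
    by case: (_ <= y)%R; rewrite /= ?subr0 ?subrr.
  by rewrite [K.+2%:R <= y]lt_geF ?subrr// (lt_le_trans lt)// ler_nat; lia.
ring.
Qed.

Let zpts (i K : nat) h : R :=
  csum (fun g => [&& fresh g, below l K%:R g & near_level i (ht g)]) h.

Lemma npts_zpts a i (K : nat) h : i%:R <= a -> a < i.+1%:R -> below l K%:R h ->
  npts l a h <= zpts i K h.
Proof.
move=> ia ai; have mono g : (slab l a (pos g)) -> near_level i (ht g).
  rewrite /slab /near_level -/(ht g) => /andP[s1 s2].
  by rewrite (le_trans ia)//= -natr1; move: ai s2; rewrite -natr1 /height; lra.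
elim: h => [|e h IH] bh.
  rewrite /npts /zpts /= !addr0 ler_nat bh /=.
  by case E: (slab l a 0) => //=; rewrite (mono [::]).
rewrite /npts /zpts !csum_cons; apply: lerD; last first.
  by apply: IH; move: bh; rewrite below_cons => /andP[].
rewrite ler_nat bh/=; case: (fresh _) => //=.
by case E: (slab _ _ _) => //=; rewrite mono.
Qed.

(** On first reaching level [i] the walk is at a record of height in [[i, i + 1)], since a step
    rises by at most 1. The next [L] steps stay below [K + L], so all the points that [HB] provides
    there are counted by [zpts i (K + L)]. *)
Lemma level_points B L (K i N : nat) g :
  (forall h, is_record l h -> B * W h <= tsum L (wnpts l W (ht h)) h) ->
  (i < K)%N -> all (fun x => dotp x l < i%:R) (trail g) -> ht g < i.+1%:R ->
  B * hit W (fun g => i%:R <= ht g) N g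
    <= tsum (N + L) (fun g => W g * zpts i (K + L) g) g.
Proof.
move=> HB iK; have z0 k : 0 <= zpts i (K + L) k by exact: csum_ge0.
have zS e k : zpts i (K + L) k <= zpts i (K + L) (e :: k) by exact: csum_homo.
have base k : all (fun x => dotp x l < i%:R) (trail k) -> ht k < i.+1%:R ->
    i%:R <= ht k -> B * W k <= tsum L (fun g => W g * zpts i (K + L) g) k.
  move=> tk ki ik; have rk : is_record l k.
    by apply/allP => x /(allP tk) /lt_le_trans; apply.
  apply: (le_trans (HB _ rk)); apply: ler_tsum => k' sk'.
  rewrite /wnpts ler_wpM2l//; apply: npts_zpts => //.
  rewrite natrD -sk'; apply: below_cat; apply/andP; split.
    by apply: lt_le_trans ki _; rewrite ler_nat.
  by apply/allP => x /(allP tk) /lt_trans; apply; rewrite ltr_nat.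
elim: N g => [|N IH] g tg gi; rewrite hitE;
  have [ig|ig] := leP i%:R (ht g).
- exact: base.
- by rewrite mulr0 tsum_ge0// => k; rewrite mulr_ge0.
- rewrite addnC; apply: le_trans (base _ tg gi ig) _.
  exact: (tsum_homo W_ge0 W_sum).
- rewrite addSn tsumS mulr_sumr; apply: ler_sum => e _; apply: IH.
    by rewrite /= -/(ht g) ig.
  rewrite ht_cons -natr1.
  have := dotp_stepv_le1 hl e; rewrite ler_norml => /andP[_]; move: ig; lra.
Qed.

(* If the walk came back below every record level, it would visit
   arbitrarily many points per level, contradicting the linear bound. *)
Lemma escape_probability (C : R) :
  (forall K n : nat, tsum n (fun g => W g *
     csum (fun g => fresh g && below l K%:R g) g) [::] <= C * (K%:R + 2)) ->
  exists t, forall n, exists2 h, is_record l h & W h / 4 <= escapes l W t n h.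
Proof.
move=> HC; apply: contrapT => H.
have no_escape t : exists n, forall h,
    is_record l h -> escapes l W t n h < W h / 4.
  move: (H) => /forallNP/(_ t)/existsNP[n Hn]; exists n => h rh.
  by rewrite ltNge; apply/negP => le; apply: Hn; exists h.
(* Each of [K] levels is reached by time [N] with probability at least 1/2, so the points number at
   least [K * B / 2] on average; a site serves at most two levels, so [HC] allows at most
   [2 * C * (K + L + 2)]. With this [B] that forces [K <= 2 * |C| * (L + 2)], against the choice of
   [K]. *)
pose B := (Num.truncn (4 * `|C| + 2)).+1.
have HB : 4 * `|C| + 2 <= B%:R by rewrite ltW// truncnS_gt.
have [L HL] := many_points hd hl hk0 HW no_escape B.
pose K := (Num.truncn (2 * `|C| * (L%:R + 2))).+1.
have HK : 2 * `|C| * (L%:R + 2) < K%:R by rewrite truncnS_gt.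
have [N HN] : exists N, forall b h n, (N <= n)%N -> b - K%:R <= ht h ->
    avoid W (fun g => b <= ht g) n h <= 2^-1 * W h.
  by apply: (avoid_level_small hd hl hk0 HW).
have lev (i : 'I_K) : B%:R / 2 <=
    tsum (N + L) (fun g => W g * zpts i (K + L) g) [::].
  apply: le_trans (_ : B%:R * hit W (fun g => i%:R <= ht g) N [::] <= _).
    rewrite ler_wpM2l//.
    have := HN i%:R [::] N (leqnn _); rewrite ht_nil subr_le0 ler_nat ltnW//.
    have := hit_avoid W_sum (fun g => i%:R <= ht g) N [::].
    by rewrite (ww_nil HW); set x := hit _ _ _ _; set y := avoid _ _ _ _; lra.
  by apply: level_points => //; rewrite ht_nil.
have : \sum_(i < K) B%:R / 2 <=
    tsum (N + L) (fun g => W g * (2 *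
      csum (fun g => fresh g && below l (K + L)%:R g) g)) [::].
  apply: (le_trans (ler_sum _ (fun i _ => lev i))).
  rewrite -tsum_sum; apply: ler_tsum => g _; rewrite -mulr_sumr ler_wpM2l//.
  have aux (a b : bool) (y : R) :
      \sum_(i < K) [&& a, b & near_level i y]%:R <= 2 * (a && b)%:R :> R.
    have [/andP[-> ->]/=|/negbTE ab] := boolP (a && b).
      by rewrite mulr1; exact: sum_near_level.
    by rewrite /= mulr0 big1// => i _; rewrite andbA ab.
  elim: (g ++ [::]) => [|e k IH]; last rewrite csum_cons mulrDr.
    have csum0 (p : pred (seq (step d))) : csum p [::] = (p [::])%:R :> R.
      by rewrite /= addr0.
    by rewrite /zpts; under eq_bigr do rewrite csum0; rewrite csum0; exact: aux.
  rewrite /zpts; under eq_bigr do rewrite csum_cons.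
  by rewrite big_split/=; apply: lerD.
rewrite sumr_const card_ord -[_ *+ K]mulr_natl.
have -> : tsum (N + L) (fun g => W g * (2 *
      csum (fun g => fresh g && below l (K + L)%:R g) g)) [::] =
    2 * tsum (N + L) (fun g => W g *
      csum (fun g => fresh g && below l (K + L)%:R g) g) [::].
  by rewrite -tsumZ; apply: eq_tsum => g _; rewrite mulrCA.
have := HC (K + L)%N (N + L)%N; set z := tsum _ _ _ => Hz Hz2.
have c0 := normr_ge0 C.
have : C * ((K + L)%:R + 2) <= `|C| * ((K + L)%:R + 2).
  by rewrite ler_wpM2r ?ler_norm// addr_ge0.
have : K%:R * ((4 * `|C| + 2) / 2) <= K%:R * (B%:R / 2).
  by rewrite ler_wpM2l//; lra.
move: Hz Hz2 HK; rewrite natrD; set k := K%:R; set c := `|C|; nra.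
Qed.

End Escape.

(** * Repeated trials *)

Section Trials.
Context {R : realType} {d : nat} (l : 'rV[R]_d).
Variables (b : R) (t : nat).
Local Notation ht := (height l).
Implicit Types (h g : seq (step d)) (e : step d).

(* The number of failed trials together with the current trial, if any: a
   trial starts at a record of height a >= b, and Some (a, m) means that the
   walk must stay above height a from m steps later on. *)
Fixpoint trial h : nat * option (R * nat) :=
  if h is e :: h' then
    let: (f, s) := trial h' in
    if s is Some (a, m) then
      (* The step [e] itself lowers the counter, so the height is tested as soon as [m] is 1. *)
      if (m <= 1)%N && (ht (e :: h') < a) then (f.+1, None)
      else (f, Some (a, m.-1))
    else if is_record l (e :: h') && (b <= ht (e :: h'))
    then (f, Some (ht (e :: h'), t)) else (f, None)
  else (0%N, None).

Definition fails h := (trial h).1.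

Lemma trial_inv h f a m : trial h = (f, Some (a, m)) ->
  b <= a /\ (m = 0%N -> a <= ht h).
Proof.
elim: h f a m => //= e h IH f a m; case: (trial h) IH => f' [[a' m']|] IH.
  case: ifPn => // nf [_ <- <-]; have [ba' _] := IH _ _ _ erefl.
  split=> // m0; move: nf; rewrite negb_and -leNgt => /orP[|//].
  by move: m0; case: (m') => [|[|k]].
by case: ifP => // /andP[_ ?] [_ <- _].
Qed.

Lemma fails_homo e h : (fails h <= fails (e :: h))%N.
Proof.
by rewrite /fails /=; case: (trial h) => f [[a m]|] /=; case: ifP.
Qed.

Section Mass.
Variable W : seq (step d) -> R.
Hypothesis W_ge0 : forall h, 0 <= W h.
Hypothesis W_sum : forall h, \sum_(e : step d) W (e :: h) = W h.
Variable rho : R.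
Hypothesis rho01 : 0 <= rho <= 1.
Hypothesis Hrho : forall n h, is_record l h ->
  tsum t (hit W (fun g => ht g < ht h) n) h <= rho * W h.

Let rho0 : 0 <= rho. Proof. by case/andP: rho01. Qed.

Let mass M n h := tsum n (fun g => W g * (M <= fails g)%N%:R) h.

Let mass_le M n h : mass M n h <= W h.
Proof.
rewrite /mass -[leRHS](tsumW W_sum n); apply: ler_tsum => g _.
by rewrite ler_piMr// lern1 leq_b1.
Qed.

(** Every failure still missing costs a factor [rho]. For the running trial this factor is replaced
    by the mass that undercuts [a] after the [m] remaining steps, which [Hrho] bounds at the start
    of the trial. *)
Lemma mass_trial M n h f s : trial h = (f, s) ->
  if s is Some (a, m) then
    (f < M)%N -> mass M n h <= rho ^+ (M - f.+1) * tsum m (hit W (fun g => ht g < a) n) h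
  else (f <= M)%N -> mass M n h <= rho ^+ (M - f) * W h.
Proof.
elim: n h f s => [|n IH] h f s hf.
  case: s hf => [[a m]|] hf fM; rewrite /mass/= /fails hf/=.
    rewrite leqNgt fM mulr0 mulr_ge0 ?exprn_ge0// tsum_ge0// => g.
    by case: ifP.
  move: fM; rewrite leq_eqVlt => /predU1P[->|fM].
    by rewrite leqnn subnn expr0 mulr1 mul1r.
  by rewrite leqNgt fM mulr0 mulr_ge0 ?exprn_ge0.
have massS : mass M n.+1 h = \sum_e mass M n (e :: h) by [].
have hS e : trial (e :: h) = let: (f, s) := trial h in
    if s is Some (a, m) then
      if (m <= 1)%N && (ht (e :: h) < a) then (f.+1, None)
      else (f, Some (a, m.-1))
    else if is_record l (e :: h) && (b <= ht (e :: h))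
    then (f, Some (ht (e :: h), t)) else (f, None) by [].
case: s hf => [[a m]|] hf fM; rewrite massS; last first.
  rewrite -W_sum mulr_sumr; apply: ler_sum => e _.
  have := hS e; rewrite hf; case: ifPn => [/andP[re _]|_] he; last exact: IH he _.
  move: fM; rewrite leq_eqVlt => /predU1P[->|fM].
    by rewrite subnn expr0 mul1r.
  apply: (le_trans (IH _ _ _ he fM)).
  have -> : (M - f = (M - f.+1).+1)%N by lia.
  by rewrite exprSr -mulrA ler_wpM2l ?exprn_ge0// Hrho.
have step e : mass M n (e :: h) <= rho ^+ (M - f.+1) *
    (if m is m'.+1 then tsum m' (hit W (fun g => ht g < a) n.+1) (e :: h)
     else hit W (fun g => ht g < a) n (e :: h)).
  have := hS e; rewrite hf; case: ifPn => [/andP[m1 lt]|nf] he.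
    apply: (le_trans (IH _ _ _ he fM)); rewrite ler_wpM2l ?exprn_ge0//.
    by move: m1; case: (m) => [|[|//]] _; rewrite /= ?hitE lt.
  apply: (le_trans (IH _ _ _ he fM)); rewrite ler_wpM2l ?exprn_ge0//.
  case: (m) => [//|m'] /=; apply: ler_tsum => g _.
  exact: (hit_homo W_ge0 (fun g => ht g < a) (g ++ e :: h) (leqnSn n)).
apply: (le_trans (ler_sum _ (fun e _ => step e))); rewrite -mulr_sumr.
rewrite ler_wpM2l ?exprn_ge0//; case: m hf step => [|m] hf _ //=.
by rewrite ltNge (trial_inv hf).2.
Qed.

Lemma mass_fails M n : W [::] = 1 -> mass M n [::] <= rho ^+ M.
Proof.
by move=> W1; have := @mass_trial M n [::] _ _ erefl (leq0n M); rewrite W1 subn0 mulr1.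
Qed.

End Mass.

(** The number of failures is monotone and bounded, hence constant from some time [n1] on. A trial
    running after [n1] never fails, and one is bound to run because the heights are unbounded. *)
Lemma trials_escape (H : nat -> seq (step d)) N :
  H 0%N = [::] -> (forall n, exists e, H n.+1 = e :: H n) ->
  (forall K : R, exists n, K <= ht (H n)) ->
  (forall n, (fails (H n) < N)%N) ->
  exists n0, forall n, (n0 <= n)%N -> b <= ht (H n).
Proof.
move=> H0 HS Hsup Hfail.
have fmono m n : (m <= n)%N -> (fails (H m) <= fails (H n))%N.
  move=> /subnK <-; elim: (n - m)%N => // k IH; rewrite addSn.
  by have [e ->] := HS (k + m)%N; exact: leq_trans IH (fails_homo _ _).
have [n1 Hn1] : exists n1, forall n, (n1 <= n)%N -> fails (H n) = fails (H n1).
  have ex : exists k, `[< exists n, fails (H n) = k >].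
    by exists (fails (H 0%N)); apply/asboolP; exists 0%N.
  have ub k : `[< exists n, fails (H n) = k >] -> (k <= N)%N.
    by move=> /asboolP[n <-]; exact: ltnW.
  case: (ex_maxnP ex ub) => k /asboolP[n1 <-] kmax; exists n1 => n nn1.
  apply/eqP; rewrite eqn_leq (fmono _ _ nn1) andbT; apply: kmax.
  by apply/asboolP; exists n.
have [n2 [n12 [f [a [m Hs]]]]] : exists n2, (n1 <= n2)%N /\
    exists f a m, trial (H n2) = (f, Some (a, m)).
  apply: contrapT => noT.
  have wait n : (n1 <= n)%N -> exists f, trial (H n) = (f, None).
    move=> nn1; case E: (trial (H n)) => [f [[a m]|]]; last by exists f.
    by case: noT; exists n; split=> //; exists f, a, m.
  have [K HK] : exists K, forall n, (n <= n1)%N -> ht (H n) < K.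
    elim: n1 {Hn1 noT wait} => [|k [K HK]].
      by exists (ht (H 0%N) + 1) => n; rewrite leqn0 => /eqP ->; rewrite ltrDl.
    exists (Num.max K (ht (H k.+1) + 1)) => n; rewrite leq_eqVlt => /predU1P[->|nk].
      by rewrite lt_max ltrDl ltr01 orbT.
    by rewrite lt_max HK.
  (* The first time the walk reaches this level is a record after [n1]; no trial is running, so one
     starts there. *)
  have ex : exists n, Num.max K b <= ht (H n) by exact: Hsup.
  case: (ex_minnP ex) => n; rewrite ge_max => /andP[Kn bn] nmin.
  have nn1 : (n1 < n)%N.
    by rewrite ltnNge; apply/negP => /HK; rewrite ltNge Kn.
  case: n Kn bn nmin nn1 => // n Kn bn nmin nn1.
  have small k : (k <= n)%N -> ht (H k) < Num.max K b.
    by move=> kn; rewrite ltNge; apply/negP => /nmin; rewrite ltnNge kn.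
  have rec : is_record l (H n.+1).
    have tr k : trail (H k) = [seq pos (H j) | j <- rev (iota 0 k)].
      elim: k => [|k IH]; first by rewrite H0.
      by have [e ->] := HS k; rewrite -[in RHS]addn1 iotaD rev_cat/= IH.
    apply/allP => x; rewrite tr => /mapP[j + ->].
    rewrite mem_rev mem_iota add0n /= ltnS => /small; rewrite -/(ht (H j)) => lt.
    by apply: (lt_le_trans lt); rewrite ge_max Kn bn.
  have [f Hf] := wait n nn1.
  have [e He] := HS n; case: noT; exists n.+1; split; first exact: ltnW.
  rewrite He in rec bn *; exists f, (ht (e :: H n)), t.
  by rewrite [LHS]/= Hf rec bn.
have [ba _] := trial_inv Hs.
have stay j : trial (H (n2 + j)%N) = (f, Some (a, (m - j)%N)).
  elim: j => [|j IH]; first by rewrite addn0 subn0.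
  have := Hn1 (n2 + j.+1)%N (leq_trans n12 (leq_addr _ _)).
  rewrite -(Hn1 (n2 + j)%N (leq_trans n12 (leq_addr _ _))) addnS.
  have [e ->] := HS (n2 + j)%N; rewrite /fails IH [trial (_ :: _)]/= IH.
  by case: ifP => _ /=; [lia|rewrite subnS].
exists (n2 + m)%N => n nm; apply: (le_trans ba).
have -> : (n = n2 + (n - n2))%N by lia.
apply: (trial_inv (stay (n - n2)%N)).2; lia.
Qed.

End Trials.

(** * Independent factors *)

Local Open Scope classical_set_scope.
Local Open Scope ring_scope.

Section BoundedMeasurable.
Context {R : realType} {dT : measure_display} {T : measurableType dT}.
Variable P : probability T R.
Implicit Types f g : T -> R.

Definition bm f := measurable_fun setT f /\ exists M, forall t, `|f t| <= M.

Local Notation E f := (\int[P]_t f t).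

Lemma bm_cst c : bm (fun=> c).
Proof. by split; [exact: measurable_cst|exists `|c|]. Qed.

Lemma bmD f g : bm f -> bm g -> bm (fun t => f t + g t).
Proof.
move=> [mf [M fM]] [mg [N gN]]; split; first exact: measurable_funD.
by exists (M + N) => t; apply: le_trans (ler_normD _ _) _; exact: lerD.
Qed.

Lemma bmM f g : bm f -> bm g -> bm (fun t => f t * g t).
Proof.
move=> [mf [M fM]] [mg [N gN]]; split; first exact: measurable_funM.
by exists (M * N) => t; rewrite normrM ler_pM.
Qed.

Lemma bmZ c f : bm f -> bm (fun t => c * f t).
Proof. exact/bmM/bm_cst. Qed.

Lemma bmB f g : bm f -> bm g -> bm (fun t => f t - g t).
Proof.
move=> bf bg; rewrite (_ : (fun _ => _) = (fun t => f t + -1 * g t)).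
  exact/bmD/bmZ.
by apply/funext => t; rewrite mulN1r.
Qed.

Lemma bm_sum (I : Type) (r : seq I) (Q : pred I) (F : I -> T -> R) :
  (forall i, bm (F i)) -> bm (fun t => \sum_(i <- r | Q i) F i t).
Proof.
move=> bF; elim: r => [|i r IH].
  by under eq_fun do rewrite big_nil; exact: bm_cst.
by under eq_fun do rewrite big_cons; case: (Q i) => //; exact: bmD.
Qed.

Lemma bm_prod (I : Type) (r : seq I) (Q : pred I) (F : I -> T -> R) :
  (forall i, bm (F i)) -> bm (fun t => \prod_(i <- r | Q i) F i t).
Proof.
move=> bF; elim: r => [|i r IH].
  by under eq_fun do rewrite big_nil; exact: bm_cst.
by under eq_fun do rewrite big_cons; case: (Q i) => //; exact: bmM.
Qed.

Lemma bm_integrable f : bm f -> P.-integrable setT (EFin \o f).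
Proof.
move=> [mf [M fM]].
apply: (@le_integrable _ _ _ _ _ _ _ (EFin \o cst M)) => //.
- exact/measurable_EFinP.
- move=> t _ /=; rewrite lee_fin; apply: (le_trans (fM t)); exact: ler_norm.
- exact: finite_measure_integrable_cst.
Qed.

Lemma ExpD f g : bm f -> bm g -> E (fun t => f t + g t) = E f + E g.
Proof. by move=> bf bg; rewrite RintegralD//; exact: bm_integrable. Qed.

Lemma ExpZ c f : bm f -> E (fun t => c * f t) = c * E f.
Proof. by move=> bf; rewrite RintegralZl//; exact: bm_integrable. Qed.

Lemma ExpB f g : bm f -> bm g -> E (fun t => f t - g t) = E f - E g.
Proof. by move=> bf bg; rewrite RintegralB//; exact: bm_integrable. Qed.

Lemma Exp_cst c : E (fun=> c) = c.
Proof. by rewrite Rintegral_cst//= (@probability_setT _ _ _ P) mulr1. Qed.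

Lemma Exp_sum (I : Type) (r : seq I) (Q : pred I) (F : I -> T -> R) :
  (forall i, bm (F i)) ->
  E (fun t => \sum_(i <- r | Q i) F i t) = \sum_(i <- r | Q i) E (F i).
Proof.
move=> bF; elim: r => [|i r IH].
  by under eq_Rintegral do rewrite big_nil; rewrite big_nil Exp_cst.
under eq_Rintegral do rewrite big_cons; rewrite big_cons.
by case: (Q i) => //; rewrite ExpD ?IH//; exact: bm_sum.
Qed.

Lemma Exp_le f g : bm f -> bm g -> (forall t, f t <= g t) -> E f <= E g.
Proof.
by move=> bf bg fg; apply: le_Rintegral => //; exact: bm_integrable.
Qed.

Lemma Exp_ge0 f : (forall t, 0 <= f t) -> 0 <= E f.
Proof. by move=> f0; apply: Rintegral_ge0. Qed.

Lemma EFin_Exp f : bm f -> (\int[P]_t (f t)%:E = (E f)%:E)%E.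
Proof.
by move=> bf; rewrite /Rintegral fineK//; apply: integrable_fin_num => //;
  exact: bm_integrable.
Qed.

Lemma Exp_norm_le f M : bm f -> (forall t, `|f t| <= M) -> `|E f| <= M.
Proof.
move=> bf fM; rewrite ler_norml; apply/andP; split.
  rewrite -(Exp_cst (- M)); apply: Exp_le => // [|t]; first exact: bm_cst.
  by have := fM t; rewrite ler_norml => /andP[].
rewrite -(Exp_cst M); apply: Exp_le => // [|t]; first exact: bm_cst.
by apply: le_trans (fM t); exact: ler_norm.
Qed.

Lemma Exp_indic (A : set T) : measurable A -> E (\1_A) = fine (P A).
Proof. by move=> mA; rewrite /Rintegral integral_indic// setIT. Qed.

End BoundedMeasurable.

(** The sum is the integer part of [y]. *)
Lemma level_count {R : realType} (N : nat) (y : R) : 0 <= y <= N%:R ->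
  `|y - \sum_(k < N) (k.+1%:R <= y)%R%:R| <= 1.
Proof.
move=> /andP[y0 yN].
suff : (N%:R <= y -> \sum_(k < N) (k.+1%:R <= y)%R%:R = N%:R :> R) /\
    (y < N%:R -> y - 1 <= \sum_(k < N) (k.+1%:R <= y)%R%:R :> R) /\
    \sum_(k < N) (k.+1%:R <= y)%R%:R <= y.
  move=> [H1 [H2 H3]]; rewrite ger0_norm ?subr_ge0//.
  move: yN; rewrite le_eqVlt => /predU1P[yN|/H2]; last by lra.
  by rewrite H1 yN ?subrr.
elim: N {yN} => [|N [IH1 [IH2 IH3]]].
  by rewrite big_ord0; split=> //; split=> //; rewrite ltNge y0.
rewrite big_ord_recr/=; have [le|lt] := leP N.+1%:R y.
  have NN : N%:R + 1 <= y by rewrite natr1.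
  by rewrite IH1; [rewrite natr1; split=> //; split=> // ; lra|lra].
rewrite addr0; split=> //; split=> // _; have [le'|lt'] := leP N%:R y; last exact: IH2.
by rewrite IH1//; move: lt; rewrite -natr1; lra.
Qed.

Section Independence.
Context {R : realType} {dT dV : measure_display}
  {T : measurableType dT} {V : measurableType dV} {I : eqType}.
Variable P : probability T R.
Variable Z : I -> T -> V.
Hypothesis mZ : forall i, measurable_fun setT (Z i).
Hypothesis indep : mutually_independent P Z.

Local Notation E f := (\int[P]_t f t).

Definition unit_fun (phi : V -> R) :=
  measurable_fun setT phi /\ forall v, 0 <= phi v <= 1.

Lemma bm_unit phi i : unit_fun phi -> bm (fun t => phi (Z i t)).
Proof.
move=> [mphi p01]; split; first exact: measurableT_comp.
by exists 1 => t; have /andP[p0 p1] := p01 (Z i t); rewrite ger0_norm.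
Qed.

Lemma unit_indic (A : set V) : measurable A -> unit_fun \1_A.
Proof.
move=> mA; split; first exact: measurable_indic.
by move=> v; rewrite indicE; case: (_ \in _); rewrite /= ler01 lexx.
Qed.

(* phi is approximated uniformly by combinations of indicators of its level
   sets. *)
Lemma lift_indic (psi : T -> R) i c phi : bm psi ->
  (forall B, measurable B ->
     E (fun t => \1_B (Z i t) * psi t) = c * E (fun t => \1_B (Z i t))) ->
  unit_fun phi ->
  E (fun t => phi (Z i t) * psi t) = c * E (fun t => phi (Z i t)).
Proof.
move=> bpsi HB uphi; have [mphi p01] := uphi.
have [_ [M psiM]] := bpsi.
have bphi := bm_unit i uphi.
apply/eqP; rewrite -subr_eq0 -normr_le0; apply/ler_addgt0Pr => eps eps0.
rewrite add0r.
have M0 : 0 <= M by apply: le_trans (psiM point).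
(* Replacing [phi] by a function within [1 / N] of it changes the two sides by at most [M / N] and
   [|c| / N]. *)
set K := M + `|c|; have K0 : 0 <= K by rewrite addr_ge0.
pose N := (Num.truncn (K / eps)).+1.
have NK : K <= N%:R * eps by rewrite -ler_pdivrMr// ltW// truncnS_gt.
have N0 : 0 < N%:R :> R by rewrite ltr0n.
pose B (k : 'I_N) : set V := [set v | k.+1%:R / N%:R <= phi v].
have mB k : measurable (B k).
  rewrite -[B k]setTI (_ : B k = phi @^-1` `[k.+1%:R / N%:R, +oo[%classic).
    exact: mphi.
  by apply/seteqP; split => v /=; rewrite in_itv/= andbT.
pose f (v : V) : R := \sum_(k < N) N%:R^-1 * \1_(B k) v.
have bBk k : bm (fun t => \1_(B k) (Z i t) : R).
  exact: (bm_unit i (unit_indic (mB k))).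
have bf : bm (fun t => f (Z i t)).
  by apply: bm_sum => k; apply: bmZ.
have fphi v : `|phi v - f v| <= N%:R^-1.
  have -> : f v = N%:R^-1 * \sum_(k < N) (k.+1%:R <= N%:R * phi v)%R%:R.
    rewrite /f mulr_sumr; apply: eq_bigr => k _; rewrite indicE.
    have -> : (v \in B k) = (k.+1%:R <= N%:R * phi v).
      by rewrite mulrC -ler_pdivrMr//; apply/idP/idP; rewrite inE.
    by [].
  have -> : phi v = N%:R^-1 * (N%:R * phi v) by rewrite mulKf// gt_eqF.
  rewrite -mulrBr normrM mulKf ?gt_eqF// ger0_norm ?invr_ge0 ?ler0n//.
  rewrite -[leRHS]mulr1 ler_wpM2l ?invr_ge0 ?ler0n//; apply: level_count.
  have /andP[p0 p1] := p01 v.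
  by rewrite mulr_ge0//= -[leRHS]mulr1 ler_wpM2l.
have Ef : E (fun t => f (Z i t) * psi t) = c * E (fun t => f (Z i t)).
  rewrite /f; under eq_Rintegral do rewrite mulr_suml.
  rewrite !Exp_sum; last 2 first.
  - by move=> k; apply: bmZ.
  - by move=> k; apply: bmM => //; apply: bmZ.
  rewrite mulr_sumr; apply: eq_bigr => k _.
  under eq_Rintegral do rewrite -mulrA.
  rewrite ExpZ ?HB//; last exact: bmM.
  by rewrite ExpZ// mulrCA.
have -> : E (fun t => phi (Z i t) * psi t) - c * E (fun t => phi (Z i t)) =
    E (fun t => (phi (Z i t) - f (Z i t)) * psi t) -
    c * E (fun t => phi (Z i t) - f (Z i t)).
  under [in RHS]eq_Rintegral do rewrite mulrBl.
  rewrite !ExpB//; try exact: bmM.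
  rewrite Ef; ring.
apply: (le_trans (ler_normB _ _)).
have H1 : `|E (fun t => (phi (Z i t) - f (Z i t)) * psi t)| <= N%:R^-1 * M.
  apply: Exp_norm_le; first by apply: bmM => //; exact: bmB.
  by move=> t; rewrite normrM ler_pM.
have H2 : `|E (fun t => phi (Z i t) - f (Z i t))| <= N%:R^-1.
  by apply: Exp_norm_le; first exact: bmB.
apply: le_trans (_ : N%:R^-1 * K <= _).
  rewrite mulrDr lerD// normrM mulrC; apply: ler_wpM2r => //.
by rewrite mulrC ler_pdivrMr// mulrC.
Qed.

(** By [lift_indic] the function at the head of [s1] may be taken to be the indicator of a set [B];
    its index then moves to [s2]. *)
Lemma indep_prod_indic (s1 s2 : seq I) (phi : I -> V -> R) (A : I -> set V) :
  uniq (s1 ++ s2) -> (forall i, unit_fun (phi i)) ->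
  (forall i, measurable (A i)) ->
  E (fun t => (\prod_(i <- s1) phi i (Z i t)) * \prod_(i <- s2) \1_(A i) (Z i t))
  = (\prod_(i <- s1) E (fun t => phi i (Z i t))) *
    \prod_(i <- s2) E (fun t => \1_(A i) (Z i t)).
Proof.
move=> + uphi; elim: s1 s2 A => [|x s1 IH] s2 A /=.
  move=> us mA; rewrite big_nil mul1r.
  under eq_Rintegral do rewrite big_nil mul1r.
  have mp i : measurable (Z i @^-1` A i) by rewrite -[_ @^-1` _]setTI; exact: mZ.
  have Ei i : E (fun t => \1_(A i) (Z i t)) = fine (P (Z i @^-1` A i)).
    by rewrite -Exp_indic.
  under [in RHS]eq_bigr do rewrite Ei.
  have -> : (fun t => \prod_(i <- s2) \1_(A i) (Z i t)) =
      \1_(\bigcap_(i in [set` s2]) Z i @^-1` A i) :> (T -> R).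
    apply/funext => t; rewrite indicE.
    elim: s2 {us} => [|i s IHs].
      rewrite big_nil (_ : _ \in _)//; rewrite inE => i; rewrite /= in_nil//.
    rewrite big_cons IHs indicE -natrM mulnb; congr ((nat_of_bool _)%:R).
    apply/idP/idP => [/andP[]|].
      rewrite !inE => Ai H j /=; rewrite in_cons => /predU1P[->//|js].
      exact: (H j).
    rewrite inE => H; apply/andP; rewrite !inE; split.
      by apply: (H i); rewrite /= mem_head.
    by move=> j js; apply: H; rewrite /= in_cons [j \in s]js orbT.
  rewrite Exp_indic; last first.
    by apply: fin_bigcap_measurable => //; exact: finite_seq.
  rewrite indep// -[RHS]/(fine (_%:E)) -prodEFin; congr fine.
  by apply: eq_bigr => i _; rewrite fineK// fin_num_measure.
move=> /andP[xs us] mA; rewrite big_cons.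
set psi := fun t => (\prod_(i <- s1) phi i (Z i t)) *
   \prod_(i <- s2) \1_(A i) (Z i t).
have bpsi : bm psi.
  by apply: bmM; apply: bm_prod => i; apply: bm_unit => //; exact: unit_indic.
transitivity (E (fun t => phi x (Z x t) * psi t)).
  by apply: eq_Rintegral => t _; rewrite big_cons mulrA.
rewrite (@lift_indic _ _ (\prod_(i <- s1) E (fun t => phi i (Z i t)) *
    \prod_(i <- s2) E (fun t => \1_(A i) (Z i t))))//; first by rewrite mulrC mulrA.
move=> B mB; pose A' i := if i == x then B else A i.
have A'x : A' x = B by rewrite /A' eqxx.
have := IH (x :: s2) A'; rewrite big_cons A'x => IHB.
have A's (F : I -> set V -> R) : \prod_(i <- s2) F i (A' i) = \prod_(i <- s2) F i (A i).
  apply: eq_big_seq => i is2; rewrite /A'; case: eqP => // ix.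
  by move: xs; rewrite mem_cat -ix is2 orbT.
rewrite (A's (fun i A => E (fun t => \1_A (Z i t)))) in IHB.
rewrite [RHS]mulrC mulrA [_ * \prod_(i <- s1) _]mulrC -mulrA -IHB.
- apply: eq_Rintegral => t _; rewrite big_cons A'x.
  by rewrite (A's (fun i A => \1_A (Z i t))) /psi mulrCA.
- by rewrite -[x :: s2]cat1s uniq_catCA cat1s cons_uniq xs us.
- by move=> i; rewrite /A'; case: ifP.
Qed.

Lemma indep_prod (s : seq I) (phi : I -> V -> R) :
  uniq s -> (forall i, unit_fun (phi i)) ->
  E (fun t => \prod_(i <- s) phi i (Z i t))
  = \prod_(i <- s) E (fun t => phi i (Z i t)).
Proof.
move=> us uphi.
have := @indep_prod_indic s [::] phi (fun=> setT); rewrite cats0 big_nil mulr1.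
move=> <- //; apply: eq_Rintegral => t _.
by rewrite big_nil mulr1.
Qed.

End Independence.

(** * Path weights in a fixed environment *)

Section Quenched.
Context {R : realType} {d : nat} (l : 'rV[R]_d) (kappa : R).
Hypothesis hd : (2 <= d)%N.
Hypothesis hl : \sum_(j < d) `|l 0 j| = 1.
Hypothesis hk0 : 0 < kappa.
Variable w : set_type (is_environment l kappa).
Local Notation ht := (height l).
Implicit Types (h g : seq (step d)) (x : lattice d) (e : step d).

Fixpoint qw h : R :=
  if h is e :: h' then qw h' * env_at w (pos h') e (nvis h') else 1.

Let w_env : is_environment l kappa (\val w) := set_valP w.

Lemma env_at_ge x e i : kappa <= env_at w x e i.
Proof. by have [/(_ x e i)/andP[]] := w_env. Qed.

Lemma env_at_le x e i : env_at w x e i <= 1 - kappa.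
Proof. by have [/(_ x e i)/andP[]] := w_env. Qed.

Lemma env_at_ge0 x e i : 0 <= env_at w x e i.
Proof. exact/(le_trans (ltW hk0))/env_at_ge. Qed.

Lemma env_at_le1 x e i : env_at w x e i <= 1.
Proof. by have := env_at_le x e i; move: hk0; lra. Qed.

Definition sdrift x i : R := \sum_(e : step d) env_at w x e i * dotp (stepv e) l.

Lemma sdrift_ge0 x i : 0 <= sdrift x i.
Proof. by have [_ [_]] := w_env; exact. Qed.

Lemma qw_ge0 h : 0 <= qw h.
Proof. by elim: h => //= e h IH; rewrite mulr_ge0// env_at_ge0. Qed.

Lemma qw_drift h :
  \sum_(e : step d) qw (e :: h) * dotp (stepv e) l = qw h * sdrift (pos h) (nvis h).
Proof. by rewrite mulr_sumr; apply: eq_bigr => e _; rewrite mulrA. Qed.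

Lemma qw_walk_weight : walk_weight l kappa qw.
Proof.
split => // [h|e h|h].
- by rewrite /= -mulr_sumr; have [_ [-> _]] := w_env; rewrite mulr1.
- by rewrite mulrC ler_wpM2l ?qw_ge0 ?env_at_ge.
- by rewrite qw_drift mulr_ge0 ?qw_ge0 ?sdrift_ge0.
Qed.

(* Optional stopping for the height of the walk, which overshoots level b by at
   most one. *)
Lemma drift_below_le (b : R) n h :
  \sum_(j < n) tsum j (fun g =>
      qw g * ((below l b g)%:R * sdrift (pos g) (nvis g))) h
    <= qw h * (if below l b h then b + 1 - ht h else 0).
Proof.
elim: n h => [|n IH] h.
  rewrite big_ord0 mulr_ge0 ?qw_ge0//; case: ifP => // /andP[+ _].
  by rewrite -/(ht h) /height; lra.
rewrite big_ord_recl.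
have -> : \sum_(i < n) tsum (lift ord0 i) (fun g =>
      qw g * ((below l b g)%:R * sdrift (pos g) (nvis g))) h =
    \sum_e \sum_(j < n) tsum j (fun g =>
      qw g * ((below l b g)%:R * sdrift (pos g) (nvis g))) (e :: h).
  by rewrite exchange_big.
apply: le_trans (_ : qw h * ((below l b h)%:R * sdrift (pos h) (nvis h)) +
   \sum_e (qw (e :: h) * (if below l b (e :: h) then b + 1 - ht (e :: h) else 0)) <= _).
  by rewrite lerD2l; apply: ler_sum => e _; exact: IH.
have [bh|nb] := boolP (below l b h); last first.
  rewrite mulr0 mul0r mulr0 add0r big1// => e _.
  by rewrite below_cons (negbTE nb) andbF mulr0.
have htb : ht h < b by move: bh => /andP[].
rewrite mul1r.
apply: le_trans (_ : qw h * sdrift (pos h) (nvis h) +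
   \sum_e (qw (e :: h) * (b + 1 - ht h) - qw (e :: h) * dotp (stepv e) l) <= _).
  rewrite lerD2l; apply: ler_sum => e _; rewrite -mulrBr.
  rewrite ler_wpM2l ?qw_ge0// below_cons bh andbT ht_cons.
  have := dotp_stepv_le1 hl e; rewrite ler_norml => /andP[_].
  by case: ifP => _; move: htb; lra.
rewrite sumrB -mulr_suml (ww_sum qw_walk_weight) qw_drift; lra.
Qed.

Let up : step d := (Ordinal (ltnW hd), false).
Let down : step d := (Ordinal (ltnW hd), true).

(** Each round goes to a neighbour and back, the latest step being listed first. After [i] rounds
    from a fresh site the walk is there again, about to use the cookie of index [i]. *)
Fixpoint back_forth i : seq (step d) :=
  if i is i'.+1 then down :: up :: back_forth i' else [::].

Let size_bf i : size (back_forth i) = (2 * i)%N.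
Proof. by elim: i => //= i ->; rewrite mulnS. Qed.

Let down_up : stepv up + stepv down = 0 :> lattice d.
Proof. by rewrite /stepv/= expr0 expr1 scale1r scaleN1r subrr. Qed.

Let up_neq0 : stepv up != 0 :> lattice d.
Proof.
apply/eqP => /matrixP/(_ 0 (Ordinal (ltnW hd))).
by rewrite stepvE eqxx mxE.
Qed.

Let pos_bf i g : pos (back_forth i ++ g) = pos g.
Proof. by elim: i => //= i ->; rewrite -addrA down_up addr0. Qed.

Let nvis_bf i g : fresh g -> nvis (back_forth i ++ g) = i.
Proof.
move=> fg; rewrite /nvis; elim: i => [|i IH]; first exact/count_memPn.
rewrite pos_bf/=; move: IH; rewrite pos_bf => ->.
by rewrite eqxx -{2}[pos g]addr0 (inj_eq (addrI _)) (negbTE up_neq0).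
Qed.

Let below_bf (b : R) i g : below l b g -> below l (b + 1) (back_forth i ++ g).
Proof.
move=> bg; have hg : ht g < b by move: bg => /andP[].
elim: i => [|i IH]; first by apply: belowW bg; rewrite lerDl.
rewrite /= !below_cons IH andbT /height /= !pos_bf -addrA down_up addr0 dotpD.
have := dotp_stepv_le1 hl up; rewrite ler_norml => /andP[_].
by move: hg; rewrite /height => hg ?; apply/andP; split; lra.
Qed.

(** From a fresh site reached at time [j], going back and forth has probability at least
    [kappa ^ (2 * i)] and stays below [K + 1]; at time [j + 2 * i] the cookie of index [i] is used.
    The sum is thus part of the drift consumed below level [K + 1], and the overshoot adds one more
    unit. *)
Lemma fresh_drift_le (K n i : nat) :
  kappa ^+ (2 * i) * \sum_(j < n) tsum j (fun g =>
      qw g * ((fresh g && below l K%:R g)%:R * sdrift (pos g) i)) [::]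
    <= K%:R + 2.
Proof.
pose F g := qw g * ((below l (K%:R + 1) g)%:R * sdrift (pos g) (nvis g)).
have F0 g : 0 <= F g by rewrite !mulr_ge0 ?qw_ge0 ?sdrift_ge0.
apply: le_trans (_ : \sum_(j < n + 2 * i) tsum j F [::] <= _); last first.
  apply: le_trans (drift_below_le _ _ _) _; rewrite mul1r ht_nil subr0.
  by case: ifP => _; rewrite -?addrA// addr_ge0.
apply: le_trans (_ : \sum_(j < n) tsum (j + 2 * i) F [::] <= _); last first.
  rewrite [(n + _)%N]addnC big_split_ord/=; apply: ler_wpDl.
    by apply: sumr_ge0 => j _; exact: tsum_ge0.
  by apply: ler_sum => j _; rewrite addnC.
rewrite mulr_sumr; apply: ler_sum => j _.
rewrite tsum_add -tsumZ; apply: ler_tsum => g _.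
have [/andP[fg bg]|_] :=
  boolP (fresh (g ++ [::]) && below l K%:R (g ++ [::])); last first.
  by rewrite mul0r !mulr0; exact: tsum_ge0.
rewrite mul1r -size_bf; apply: le_trans (tsum_ge1 _ _ F0).
rewrite /F below_bf// mul1r pos_bf nvis_bf// mulrA ler_wpM2r ?sdrift_ge0//.
exact: (ww_ell_cat hk0 qw_walk_weight).
Qed.

End Quenched.

(** * Averaging over the environment *)

Lemma borel_measurable_fun {R : realType} (T : ptopologicalType) (f : T -> R) :
  continuous f -> measurable_fun setT (f : borel T -> R).
Proof.
move=> /continuousP cf; apply: (measurability _ (RGenOpens.measurableE R)).
move=> _ [_ [a [b ->] <-]]; rewrite setTI; apply: sub_sigma_algebra.
exact/cf/interval_open.
Qed.

Section Annealed.
Context {R : realType} {d : nat} (l : 'rV[R]_d) (kappa : R).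
Context (hd : (2 <= d)%N) (hk0 : 0 < kappa) (hk1 : kappa <= (2 * d%:R)^-1).
Hypothesis hl : \sum_(j < d) `|l 0 j| = 1.
Local Notation Omega := (environment l hd hk0 hk1).
Variable P : probability (borel Omega) R.
Hypothesis hiid : iid P (env_site : lattice d -> borel Omega ->
                              borel (site_env R d)).
Local Notation ht := (height l).
Implicit Types (h g : seq (step d)) (x : lattice d) (e : step d) (w : borel Omega).

Local Notation E f := (\int[P]_w f w).

Lemma env_at_continuous x e i :
  continuous (fun w : Omega => env_at w x e i).
Proof.
move=> w; apply: (@continuous_comp _ _ _ (\val : Omega -> {ptws _ -> R})
  (fun f : {ptws (lattice d * step d * nat) -> R} => f (x, e, i))).
  exact: initial_continuous.
exact: (@proj_continuous _ (fun _ => R) (x, e, i)).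
Qed.

Lemma bm_env_at x e i : bm (fun w => env_at w x e i).
Proof.
split; first exact: (borel_measurable_fun (@env_at_continuous x e i)).
exists 1 => w; rewrite ger0_norm; first exact: (env_at_le1 hk0).
exact: (env_at_ge0 hk0).
Qed.

Lemma bm_qw h : bm (fun w => qw w h).
Proof.
by elim: h => [|e h IH] /=; [exact: bm_cst|apply: bmM => //; exact: bm_env_at].
Qed.

Definition mono (J : seq (lattice d * step d * nat)) w : R :=
  \prod_(t <- J) env_at w t.1.1 t.1.2 t.2.

Definition sites (J : seq (lattice d * step d * nat)) := [seq t.1.1 | t <- J].

Definition shift x (J : seq (lattice d * step d * nat)) :=
  [seq (t.1.1 + x, t.1.2, t.2) | t <- J].

Lemma bm_mono J : bm (mono J).
Proof. by apply: bm_prod => t; exact: bm_env_at. Qed.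

(** The entries are forced into [[0, 1]] because [unit_fun] asks for bounds on all of [site_env]; on
    environments this changes nothing. *)
Let site_factor J x (s : borel (site_env R d)) : R :=
  \prod_(t <- J | t.1.1 == x) Num.min `|s (t.1.2, t.2)| 1.

Let unit_site_factor J x : unit_fun (site_factor J x).
Proof.
split=> [|s]; rewrite /site_factor; last first.
  have m0 (y : R) : 0 <= Num.min `|y| 1 by rewrite le_min normr_ge0 ler01.
  have m1 (y : R) : Num.min `|y| 1 <= 1 by rewrite ge_min lexx orbT.
  rewrite prodr_ge0//=; elim: J => [|t J IH]; first by rewrite big_nil.
  by rewrite big_cons; case: ifP => // _; rewrite mulr_ile1// prodr_ge0.
elim: J => [|t J IH].
  by under eq_fun do rewrite big_nil; exact: measurable_cst.
under eq_fun do rewrite big_cons; case: (_ == _) => //.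
apply: measurable_funM => //; apply: measurable_minr => //.
apply: measurableT_comp => //; apply: borel_measurable_fun.
exact: (@proj_continuous _ (fun _ => R) (t.1.2, t.2)).
Qed.

Let mono_site s J w : uniq s -> {subset sites J <= s} ->
  mono J w = \prod_(x <- s) site_factor J x (env_site x w).
Proof.
move=> us sJ.
have E1 x : site_factor J x (env_site x w) =
    \prod_(t <- J | t.1.1 == x) env_at w t.1.1 t.1.2 t.2.
  apply: eq_bigr => t /eqP <-; rewrite /env_site /=.
  rewrite ger0_norm; last exact: (env_at_ge0 hk0).
  by rewrite min_l//; exact: (env_at_le1 hk0).
under [RHS]eq_bigr do rewrite E1.
rewrite (exchange_big_dep predT)//= /mono big_seq [RHS]big_seq.
apply: eq_bigr => t tJ; rewrite -big_filter.
have -> : [seq x <- s | t.1.1 == x] = [:: t.1.1].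
  rewrite -[RHS](@filter_pred1_uniq _ s t.1.1)//; last exact/sJ/map_f.
  by apply: eq_filter => x /=; rewrite eq_sym.
by rewrite big_seq1.
Qed.

Let E_mono s J : uniq s -> {subset sites J <= s} ->
  E (mono J) = \prod_(x <- s) E (fun w => site_factor J x (env_site x w)).
Proof.
move=> us sJ; have [mZ [ind _]] := hiid.
rewrite -(indep_prod mZ ind us (unit_site_factor J)).
by apply: eq_Rintegral => w _; exact: mono_site.
Qed.

(** Both sides factor over the sites, and at each site at most one of the two monomials
    contributes. *)
Lemma mono_indep J1 J2 : ~~ has (mem (sites J1)) (sites J2) ->
  E (fun w => mono J1 w * mono J2 w) = E (mono J1) * E (mono J2).
Proof.
move=> dis; pose s := undup (sites (J1 ++ J2)).
have us : uniq s by exact: undup_uniq.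
have -> : E (fun w => mono J1 w * mono J2 w) = E (mono (J1 ++ J2)).
  by apply: eq_Rintegral => w _; rewrite /mono big_cat.
have s1 : {subset sites J1 <= s}.
  by move=> x xJ; rewrite mem_undup /sites map_cat mem_cat xJ.
have s2 : {subset sites J2 <= s}.
  by move=> x xJ; rewrite mem_undup /sites map_cat mem_cat [x \in map _ J2]xJ orbT.
rewrite (E_mono us s1) (E_mono us s2) (@E_mono s (J1 ++ J2))//; last first.
  by move=> x; rewrite mem_undup.
rewrite -big_split/=; apply: eq_bigr => x _.
have emp J : x \notin sites J -> forall s, site_factor J x s = 1.
  move=> xJ s0; rewrite /site_factor big_seq_cond big1// => t /andP[tJ /eqP tx].
  by case/negP: xJ; rewrite -tx; exact: (map_f (fun t => t.1.1) tJ).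
have sp s0 : site_factor (J1 ++ J2) x s0 = site_factor J1 x s0 * site_factor J2 x s0.
  by rewrite /site_factor big_cat.
under eq_Rintegral do rewrite sp.
have [x2|x2] := boolP (x \in sites J2); last first.
  under eq_Rintegral do rewrite (emp J2 x2) mulr1.
  by under [X in _ = _ * X]eq_Rintegral do rewrite (emp J2 x2); rewrite Exp_cst mulr1.
have x1 : x \notin sites J1.
  by apply: contra dis => x1; apply/hasP; exists x.
under eq_Rintegral do rewrite (emp J1 x1) mul1r.
by under [X in _ = X * _]eq_Rintegral do rewrite (emp J1 x1); rewrite Exp_cst mul1r.
Qed.

(** Both means factor over the sites, and the environments at [y + x] and at [y] have the same
    law. *)
Lemma mono_shift x J : E (mono (shift x J)) = E (mono J).
Proof.
pose s := undup (sites J).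
have us : uniq s by exact: undup_uniq.
have inj : injective (fun y : lattice d => y + x) by exact: addIr.
rewrite (@E_mono s J us); last by move=> y; rewrite mem_undup.
rewrite (@E_mono [seq y + x | y <- s]); last 2 first.
- by rewrite map_inj_uniq.
- move=> _ /mapP[_ /mapP[t tJ ->] ->] /=; apply: map_f.
  by rewrite mem_undup; apply: map_f.
rewrite big_map; apply: eq_bigr => y _.
have -> : site_factor (shift x J) (y + x) = site_factor J y.
  apply/funext => s0; rewrite /site_factor big_map/=.
  by apply: eq_bigl => t; rewrite (inj_eq (addIr x)).
have [mZ [_ ident]] := hiid.
have [mphi p01] := unit_site_factor J y.
pose phi := site_factor J y.
rewrite /Rintegral; congr fine.
have tr z : (\int[P]_w (phi (env_site z w))%:E =
    \int[pushforward P (env_site z : borel Omega -> borel (site_env R d))]_s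
      (phi s)%:E)%E.
  rewrite (ge0_integral_pushforward (mZ z))//.
    exact/measurable_EFinP.
  by move=> s0 _; rewrite lee_fin; have /andP[] := p01 s0.
rewrite [LHS]tr [RHS]tr; apply: eq_measure_integral => A mA _.
exact: ident.
Qed.


Fixpoint word h : seq (lattice d * step d * nat) :=
  if h is e :: h' then (pos h', e, nvis h') :: word h' else [::].

Lemma sites_word h : sites (word h) = trail h.
Proof. by elim: h => //= e h <-. Qed.

Lemma qw_mono h w : qw w h = mono (word h) w.
Proof.
by elim: h => [|e h IH]; rewrite /mono ?big_nil// big_cons/= IH mulrC.
Qed.

Definition aw h : R := E (fun w => qw w h).

Lemma aw_mono h : aw h = E (mono (word h)).
Proof. by apply: eq_Rintegral => w _; exact: qw_mono. Qed.

Lemma aw_walk_weight : walk_weight l kappa aw.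
Proof.
have ww w := qw_walk_weight hk0 w.
split => [|h|e h|h].
- by rewrite /aw /= Exp_cst.
- rewrite /aw -Exp_sum; last by move=> e; exact: bm_qw.
  by apply: eq_Rintegral => w _; exact: (ww_sum (ww w)).
- rewrite /aw -ExpZ; last exact: bm_qw.
  apply: Exp_le; [exact/bmZ/bm_qw|exact: bm_qw|].
  by move=> w; exact: (ww_ell (ww w)).
- rewrite (_ : \sum_e _ = E (fun w => \sum_e qw w (e :: h) * dotp (stepv e) l)).
    by apply: Exp_ge0 => w; exact: (ww_drift (ww w)).
  rewrite Exp_sum; last first.
    by move=> e; apply: bmM; [exact: bm_qw|exact: bm_cst].
  apply: eq_bigr => e _; rewrite mulrC -ExpZ; last exact: bm_qw.
  by apply: eq_Rintegral => w _; rewrite mulrC.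
Qed.

Lemma bm_tsum (F : borel Omega -> seq (step d) -> R) n h :
  (forall g, bm (fun w => F w g)) -> bm (fun w => tsum n (F w) h).
Proof. by move=> bF; elim: n h => //= n IH h; apply: bm_sum. Qed.

Lemma Exp_tsum (F : borel Omega -> seq (step d) -> R) n h :
  (forall g, bm (fun w => F w g)) ->
  E (fun w => tsum n (F w) h) = tsum n (fun g => E (fun w => F w g)) h.
Proof.
move=> bF; elim: n h => //= n IH h; rewrite Exp_sum; last first.
  by move=> e; exact: bm_tsum.
by apply: eq_bigr => e _; exact: IH.
Qed.

Lemma bm_sdrift x i : bm (fun w => sdrift w x i).
Proof.
by apply: bm_sum => e; apply: bmM; [exact: bm_env_at|exact: bm_cst].
Qed.

Definition mean_drift i : R := E (fun w => sdrift w 0 i).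

(** [qw w h] involves only the sites of [trail h]. A fresh [pos h] is not among them, so its
    environment is independent of this weight. *)
Lemma fresh_drift_mean h i : fresh h ->
  E (fun w => qw w h * sdrift w (pos h) i) = aw h * mean_drift i.
Proof.
move=> fh.
have mean e : E (fun w => env_at w (pos h) e i) = E (fun w => env_at w 0 e i).
  have m1 y : E (fun w => env_at w y e i) = E (mono [:: (y, e, i)]).
    by apply: eq_Rintegral => w _; rewrite /mono big_seq1.
  rewrite (m1 (pos h)) (m1 0) -(mono_shift (pos h) [:: (0, e, i)]).
  by rewrite /shift/= add0r.
rewrite /mean_drift /sdrift.
under eq_Rintegral do rewrite mulr_sumr.
rewrite !Exp_sum; last 2 first.
- by move=> e; apply: bmM; [exact: bm_env_at|exact: bm_cst].
- move=> e; apply: bmM; first exact: bm_qw.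
  by apply: bmM; [exact: bm_env_at|exact: bm_cst].
rewrite mulr_sumr; apply: eq_bigr => e _.
transitivity (dotp (stepv e) l * (aw h * E (fun w => env_at w (pos h) e i))).
  rewrite aw_mono.
  have -> : E (fun w => env_at w (pos h) e i) = E (mono [:: (pos h, e, i)]).
    by apply: eq_Rintegral => w _; rewrite /mono big_seq1.
  rewrite -mono_indep; last first.
    by rewrite /= orbF; move: fh; rewrite /fresh -sites_word.
  rewrite -ExpZ; last by apply: bmM; exact: bm_mono.
  apply: eq_Rintegral => w _; rewrite qw_mono.
  by rewrite [mono [:: _] w]big_seq1/=; ring.
rewrite mean mulrCA; congr (_ * _); rewrite -ExpZ; last exact: bm_env_at.
by apply: eq_Rintegral => w _; rewrite mulrC.
Qed.

(** This is [fresh_drift_le] averaged over the environment; [tsum_csum] turns the sum over times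
    into a count of sites. *)
Lemma fresh_points_le (K n i : nat) :
  kappa ^+ (2 * i) * mean_drift i * tsum n (fun g => aw g *
     csum (fun g => fresh g && below l K%:R g) g) [::] <= K%:R + 2.
Proof.
have bF g : bm (fun w => qw w g *
    ((fresh g && below l K%:R g)%:R * sdrift w (pos g) i)).
  apply: bmM; first exact: bm_qw.
  by apply: bmM; [exact: bm_cst|exact: bm_sdrift].
have := Exp_le P (bmZ _ (bm_sum _ _ (fun j : 'I_n.+1 => bm_tsum j [::] bF)))
  (bm_cst (K%:R + 2)) (fun w => fresh_drift_le hd hl hk0 w K n.+1 i).
rewrite Exp_cst ExpZ; last by apply: bm_sum => j; exact: bm_tsum.
rewrite Exp_sum; last by move=> j; exact: bm_tsum.
apply: le_trans; rewrite -mulrA; apply: ler_wpM2l.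
  by rewrite exprn_ge0// ltW.
rewrite tsum_csum; last exact: (ww_sum aw_walk_weight).
rewrite big_mkord mulr_sumr; apply: ler_sum => j _.
rewrite Exp_tsum// -tsumZ; apply: ler_tsum => g _.
have [/andP[fg bg]|_] :=
  boolP (fresh (g ++ [::]) && below l K%:R (g ++ [::])); last first.
  rewrite mulr0 mulr0; apply: Exp_ge0 => w.
  by rewrite mul0r mulr0.
under eq_Rintegral do rewrite mul1r.
by rewrite fresh_drift_mean// mulr1 mulrC.
Qed.


Definition word_above g := [seq t <- word g | 0 <= dotp t.1.1 l].

Definition depth g := count (fun x => dotp x l < 0) (trail g).

(* After a record, the part of the path in the half-space above the record is
   governed by a fresh environment. *)
Lemma qw_record g h w : is_record l h ->
  kappa ^+ depth g * (mono (shift (pos h) (word_above g)) w * qw w h) <= qw w (g ++ h)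
    <= mono (shift (pos h) (word_above g)) w * qw w h.
Proof.
move=> rh; elim: g => [|e g /andP[IH1 IH2]].
  by rewrite /= /mono big_nil mul1r mul1r lexx.
have mono0 J : 0 <= mono J w by apply: prodr_ge0 => t _; exact: (env_at_ge0 hk0).
have q0 k : 0 <= qw w k by exact: qw_ge0.
set p := env_at w (pos (g ++ h)) e (nvis (g ++ h)).
have p0 : 0 <= p by exact: (env_at_ge0 hk0).
have p1 : p <= 1 by exact: (env_at_le1 hk0).
have pk : kappa <= p by exact: env_at_ge.
have -> : qw w ((e :: g) ++ h) = qw w (g ++ h) * p by [].
have [ge|lt] := leP 0 (ht g).
  (* The earlier positions of [h] all lie strictly below [ht h], so only [g] can have visited this
     site. *)
  have vis : nvis (g ++ h) = nvis g.
    rewrite /nvis trail_cat count_cat pos_cat addnC (count_memPn _) ?add0n.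
      rewrite count_map; apply: eq_count => y /=.
      by rewrite (inj_eq (addIr (pos h))).
    by apply/negP => /(allP rh); rewrite dotpD -/(ht g) -/(ht h) gtrDr ltNge ge.
  have -> : depth (e :: g) = depth g.
    by rewrite /depth/= -/(ht g) ltNge ge.
  have -> : mono (shift (pos h) (word_above (e :: g))) w =
      p * mono (shift (pos h) (word_above g)) w.
    rewrite /word_above /= -/(ht g) ge /mono /= big_cons /=.
    by rewrite /p pos_cat vis.
  apply/andP; split.
    by rewrite -(mulrA p) mulrCA mulrC ler_wpM2r.
  by rewrite -mulrA mulrC ler_wpM2l.
have -> : depth (e :: g) = (depth g).+1.
  by rewrite /depth/= -/(ht g) lt.
have -> : word_above (e :: g) = word_above g.
  by rewrite /word_above/= -/(ht g) leNgt lt.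
rewrite exprS; set m := mono _ w * _ in IH1 IH2 *.
have m0 : 0 <= m by rewrite mulr_ge0.
apply/andP; split.
  rewrite -mulrA mulrC; apply: ler_pM => //.
    by rewrite mulr_ge0// exprn_ge0// ltW.
  exact: ltW.
by apply: le_trans IH2; rewrite ler_piMr.
Qed.

(** The two factors in [qw_record] use disjoint sets of sites, separated by the height of the
    record, so they are independent. *)
Lemma aw_record g h : is_record l h ->
  kappa ^+ depth g * (E (mono (word_above g)) * aw h) <= aw (g ++ h)
    <= E (mono (word_above g)) * aw h.
Proof.
move=> rh.
have bmm : bm (fun w => mono (shift (pos h) (word_above g)) w * qw w h).
  by apply: bmM; [exact: bm_mono|exact: bm_qw].
have <- : E (fun w => mono (shift (pos h) (word_above g)) w * qw w h) =
    E (mono (word_above g)) * aw h.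
  rewrite -(mono_shift (pos h)) aw_mono -mono_indep.
    by apply: eq_Rintegral => w _; rewrite qw_mono.
  apply/hasP => -[x]; rewrite sites_word => /(allP rh) lt.
  rewrite /= /sites => /mapP[_ /mapP[t + ->] xE].
  rewrite mem_filter => /andP[ge _]; move: lt.
  by rewrite xE /= dotpD -/(ht h) gtrDr ltNge ge.
apply/andP; split.
  rewrite -ExpZ//; apply: Exp_le; [exact: bmZ|exact: bm_qw|] => w.
  by have /andP[] := qw_record g w rh.
apply: Exp_le; [exact: bm_qw|exact: bmm|] => w.
by have /andP[] := qw_record g w rh.
Qed.

(** Here [g] is the path relative to a record. The condition does not involve the record itself,
    which makes escapes from different records comparable. *)
Fixpoint stays t g := ((size g < t)%N || (0 <= ht g)) &&
  (if g is _ :: g' then stays t g' else true).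

Lemma stays_short t g : (size g < t)%N -> stays t g.
Proof. by elim: g => [|e g IH] /= lt; rewrite lt//= IH// ltnW. Qed.

Lemma depth_stays t g : stays t g ->
  (if g is _ :: g' then depth g <= t else true)%N.
Proof.
case: g => // e g /=; rewrite andbC => /andP[+ _]; rewrite /depth /= -/(depth g).
elim: g => [|e' g IH]; first by rewrite /depth/= dotp0 ltxx.
move=> /= /andP[/orP[lt|ge] sg].
  apply: leq_trans lt; rewrite (leq_trans (leq_add (leq_b1 _) (count_size _ _)))//.
  suff -> : size (trail (e' :: g)) = (size g).+1 by [].
  by elim: g {IH sg} e' => //= e'' g IH _; rewrite -(IH e'').
by rewrite -/(ht (e' :: g)) ltNge ge/= add0n; exact: IH.
Qed.

Lemma escapes_stays (W : seq (step d) -> R) t n h : escapes l W t n h =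
  tsum (t + n) (fun g => W (g ++ h) * (stays t g)%:R) [::].
Proof.
pose prev g := if g is _ :: g' then stays t g' else true.
have key m g : (t <= size g)%N ->
    tsum m (fun g => W (g ++ h) * (stays t g)%:R) g =
    (prev g)%:R * avoid W (fun g => ht g < ht h) m (g ++ h).
  have htE g' : (ht (g' ++ h) < ht h) = (ht g' < 0).
    by rewrite ht_cat gtrDr.
  have stE g' : (t <= size g')%N -> stays t g' = (0 <= ht g') && prev g'.
    by case: g' => [|e' g'] /= tg; rewrite ltnNge tg.
  elim: m g => [|m IH] g tg; rewrite avoidE htE.
    rewrite /= stE// leNgt; case: (ht g < 0) => /=; rewrite ?mulr0//.
    by rewrite mulrC.
  rewrite tsumS (eq_bigr (fun e => (stays t g)%:R *
    avoid W (fun g => ht g < ht h) m (e :: g ++ h))); last first.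
    by move=> e _; rewrite IH//; exact: leqW.
  rewrite -mulr_sumr stE// leNgt; case: (ht g < 0) => /=; rewrite ?mul0r ?mulr0//.
rewrite tsum_add /escapes -{2}[h]cat0s tsum_cat; apply: eq_tsum => g sg.
rewrite cats0 in sg *; rewrite key ?sg//.
have -> : prev g = true; last by rewrite mul1r.
by move: sg; case: g => //= e g [] <-; rewrite stays_short.
Qed.

Lemma kappa_le1 : kappa <= 1.
Proof.
apply: (le_trans hk1); rewrite invf_le1 ?mulr_gt0// ?ltr0n; last by lia.
by rewrite -natrM ler1n; lia.
Qed.

(** [aw_record] compares the escape from any record with the sum [F], which does not depend on the
    record. The upper bound at [k] gives [c <= F]; the lower bound at [h] loses at most [kappa ^ t],
    as an escaping path makes at most [t] steps from below the record. *)
Lemma uniform_escape (c : R) t :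
  (forall n, exists2 h, is_record l h & aw h * c <= escapes l aw t n h) ->
  forall n h, is_record l h -> kappa ^+ t * c * aw h <= escapes l aw t n h.
Proof.
move=> H n h rh; have [k rk Hk] := H n.
have ww := aw_walk_weight.
pose F := tsum (t + n) (fun g => E (mono (word_above g)) * (stays t g)%:R) [::].
have E0 J : 0 <= E (mono J).
  by apply: Exp_ge0 => w; apply: prodr_ge0 => u _; exact: (env_at_ge0 hk0).
have cF : c <= F.
  rewrite -(ler_pM2l (ww_gt0 hk0 ww k)); apply: (le_trans Hk).
  rewrite escapes_stays /F -tsumZ; apply: ler_tsum => g _.
  rewrite cats0 mulrA ler_wpM2r// mulrC.
  by have /andP[] := aw_record g rk.
rewrite escapes_stays; apply: le_trans (_ : kappa ^+ t * F * aw h <= _).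
  by rewrite ler_wpM2r ?(ww_ge0 hk0 ww)// ler_wpM2l// exprn_ge0// ltW.
rewrite mulrAC /F -tsumZ; apply: ler_tsum => g sg.
rewrite cats0 mulrA; have [st|_] := boolP (stays t g); last by rewrite !mulr0.
rewrite !mulr1; have /andP[+ _] := aw_record g rh; apply: le_trans.
rewrite -mulrA [aw h * _]mulrC; apply: ler_wpM2r.
  by rewrite mulr_ge0// (ww_ge0 hk0 ww).
have k1 := kappa_le1.
have : (depth g <= t)%N.
  by have := depth_stays st; case: g {sg st} => //; rewrite /depth.
by move=> dt; apply: ler_wiXn2l => //; exact: ltW.
Qed.

End Annealed.

(** * Excited random walks *)

Lemma measure_bigcup_nd_le {R : realType} {dT : measure_display}
    {T : measurableType dT} (mu : {measure set T -> \bar R})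
    (F : (set T)^nat) (c : \bar R) :
  (forall n, measurable (F n)) -> (forall n, F n `<=` F n.+1) ->
  (forall n, (mu (F n) <= c)%E) -> (mu (\bigcup_n F n) <= c)%E.
Proof.
move=> mF ndF Fc.
have cv : mu \o F @ \oo --> mu (\bigcup_n F n).
  apply: nondecreasing_cvg_mu => //; first exact: bigcupT_measurable.
  by apply/nondecreasing_seqP => n; apply/subsetPset/ndF.
rewrite -(cvg_lim _ cv)//; apply: lime_le; first by apply/cvg_ex; eexists; exact: cv.
by apply: nearW => n; exact: Fc.
Qed.

Lemma measure_le_eps0 {R : realType} (x : \bar R) : (0 <= x)%E ->
  (forall eps : R, 0 < eps -> (x <= eps%:E)%E) -> x = 0%E.
Proof.
move=> x0 H; apply/eqP; rewrite eq_le x0 andbT.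
by apply/lee_addgt0Pr => eps eps0; rewrite add0e; exact: H.
Qed.

Section Walk.
Context {R : realType} {d : nat} (l : 'rV[R]_d) (kappa : R).
Hypothesis hd : (2 <= d)%N.
Hypothesis hl : \sum_(j < d) `|l 0 j| = 1.
Hypothesis hk0 : 0 < kappa.
Variable w : set_type (is_environment l kappa).
Context {dT : measure_display} {T : measurableType dT} {Q : probability T R}.
Variable X : nat -> {RV Q >-> lattice d}.
Hypothesis HX : is_ERW 0 w X.
Local Notation ht := (height l).
Implicit Types (h g : seq (step d)) (e : step d) (t : T) (B : pred (seq (step d))).

Fixpoint cyl h : set T :=
  if h is e :: h' then cyl h' `&` [set t | X (size h) t = pos h]
  else [set t | X 0%N t = pos [::]].

Let hist := history (fun m => X m : T -> lattice d).

Let hist_X n m x : (m <= n)%N -> hist n [set t | X m t = x].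
Proof.
move=> mn; apply: sub_sigma_algebra; exists m; first by rewrite /= ltnS.
by exists [set x] => //; rewrite setTI.
Qed.

Let hist_mono n : hist n `<=` hist n.+1.
Proof.
apply: sub_sigma_algebra2 => A [m /= mn HA]; exists m => //=.
by rewrite ltnS ltnW.
Qed.

Let hist_cyl h : hist (size h) (cyl h).
Proof.
elim: h => [|e h IH]; first exact: hist_X.
apply: (@measurableI _ (g_sigma_algebraType
  (\bigcup_(m in `I_(size h).+2)
    preimage_set_system setT (X m : T -> lattice d) measurable))).
  exact: hist_mono.
exact: hist_X.
Qed.

Let measurable_X m x : measurable [set t | X m t = x].
Proof.
have mx : measurable ([set x] : set (lattice d)) by [].
exact: (measurable_funPTI (X m) mx).
Qed.

Lemma measurable_cyl h : measurable (cyl h).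
Proof.
by elim: h => [|e h IH] /=; [exact: measurable_X|exact: measurableI].
Qed.

Lemma cyl_last h t : cyl h t -> X (size h) t = pos h.
Proof. by case: h => [|e h] //= []. Qed.

Let cyl_trail h t : cyl h t ->
  trail h = [seq X m t : lattice d | m <- rev (iota 0 (size h))].
Proof.
elim: h => // e h IH [ch _].
by rewrite [size _]/= -addn1 iotaD rev_cat/= (IH ch) (cyl_last ch).
Qed.

Lemma cyl_visits h t : cyl h t ->
  (visits (fun m => X m : T -> lattice d) (size h) t).-1 = nvis h.
Proof.
move=> ch; have cnt (B : pred nat) n : #|[pred m : 'I_n | B m]| = count B (iota 0 n).
  by rewrite -sum1_card -sum1_count -[in RHS](subn0 n) -/(index_iota 0 n) big_mkord.
rewrite /visits (cnt (fun m => X m t == X (size h) t)) -addn1 iotaD count_cat/=.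
by rewrite eqxx addn1 /nvis (cyl_trail ch) count_map count_rev -(cyl_last ch).
Qed.

(** The cylinder of [h] belongs to the history up to time [size h], and on it the conditional
    probability of the next step is almost surely constant. *)
Lemma prob_cyl h : Q (cyl h) = (qw w h)%:E.
Proof.
have [Q0 [p [Hp Hae]]] := HX.
elim: h => [|e h IH]; first exact: Q0.
have [_ [intp /(_ _ (@hist_cyl h)) pB]] := Hp (size h) e.
have -> : cyl (e :: h) =
    [set t | X (size h).+1 t = X (size h) t + stepv e] `&` cyl h.
  apply/seteqP; split => t /=.
    by move=> [ch ->]; split=> //; rewrite (cyl_last ch).
  by move=> [-> ch]; split=> //; rewrite (cyl_last ch).
rewrite -pB.
have -> : (\int[Q]_(t in cyl h) (p (size h) e t)%:E =
    \int[Q]_(t in cyl h) (cst (env_at w (pos h) e (nvis h))%:E) t)%E.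
  apply: ae_eq_integral => //.
  - exact: measurable_cyl.
  - apply: measurable_funS (measurable_int _ intp) => //.
  - apply: filterS Hae => t Ht ch /=; rewrite Ht (cyl_last ch).
    by rewrite cyl_visits.
rewrite integral_cst; last exact: measurable_cyl.
by rewrite [X in (_ * X)%E]IH muleC.
Qed.

Lemma cyl_inj g h t : size g = size h -> cyl g t -> cyl h t -> g = h.
Proof.
elim: g h => [|e g IH] [|e' h] //= [sgh] [cg eg] [ch eh].
have gh := IH _ sgh cg ch; rewrite -gh in eh *; congr (_ :: _).
by apply: stepv_inj; apply: (addrI (pos g)); rewrite -eg -eh.
Qed.

Fixpoint ext B n h : set T :=
  if n is n'.+1 then \bigcup_(e in [set: step d]) ext B n' (e :: h)
  else if B h then cyl h else set0.

Lemma extP B n h t : ext B n h t <-> exists g,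
  [/\ size g = n, cyl (g ++ h) t & B (g ++ h)].
Proof.
elim: n h => [|n IH] h /=; split.
- by case: ifP => // Bh ch; exists [::].
- by move=> [g [/size0nil -> ch ->]].
- move=> [e _ /IH[g [sg cg Bg]]]; exists (rcons g e).
  by rewrite size_rcons sg cat_rcons.
- move=> [g]; case/lastP: g => [[]//|g e]; rewrite size_rcons cat_rcons.
  by move=> [[sg] cg Bg]; exists e => //; apply/IH; exists g.
Qed.

Lemma measurable_ext B n h : measurable (ext B n h).
Proof.
elim: n h => [|n IH] h /=.
  by case: ifP => // _; exact: measurable_cyl.
by apply: fin_bigcup_measurable => //; exact: finite_finset.
Qed.

Let cyl_cat g h t : cyl (g ++ h) t -> cyl h t.
Proof. by elim: g => // e g IH [/IH]. Qed.

Lemma prob_ext B n h :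
  Q (ext B n h) = (tsum n (fun g => qw w g * (B g)%:R) h)%:E.
Proof.
elim: n h => [|n IH] h /=.
  by case: ifP => _; rewrite ?measure0 ?mulr0// mulr1 prob_cyl.
rewrite measure_fin_bigcup//; last 2 first.
- move=> e e' _ _ [t [/extP[g [sg cg _]] /extP[g' [sg' cg' _]]]].
  have := cyl_inj _ (cyl_cat cg) (cyl_cat cg').
  by move=> /(_ erefl) [].
- by move=> e _; exact: measurable_ext.
rewrite (fsbig_fwiden (index_enum _)) ?index_enum_uniq//; last 2 first.
- by move=> e _ /=; rewrite mem_index_enum.
- by move=> e /= [_ []].
  by rewrite -sumEFin; apply: eq_bigr => e _; exact: IH.
exact: finite_finset.
Qed.

(* The steps of X are unit vectors and X starts at 0. *)
Definition good : set T := \bigcap_n ext predT n [::].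

Lemma measurable_good : measurable good.
Proof. by apply: bigcapT_measurable => n; exact: measurable_ext. Qed.

Lemma prob_not_good : Q (~` good) = 0%E.
Proof.
have -> : ~` good = \bigcup_n ~` ext predT n [::] by rewrite /good setC_bigcap.
apply: measure_negligible.
  by apply: bigcupT_measurable => n; apply: measurableC; exact: measurable_ext.
apply: negligible_bigcup => n; apply/negligibleP.
  by apply: measurableC; exact: measurable_ext.
have := probability_setC Q (measurable_ext predT n [::]).
rewrite prob_ext (eq_tsum (G := qw w)); last by move=> g _; rewrite mulr1.
by rewrite (tsumW (ww_sum (qw_walk_weight hk0 w))) /= subee.
Qed.

Lemma good_path t : good t -> exists H : nat -> seq (step d),
  [/\ H 0%N = [::], (forall n, exists e, H n.+1 = e :: H n),
      (forall n, size (H n) = n) & forall n, cyl (H n) t].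
Proof.
move=> gt; have HH n : exists h, size h = n /\ cyl h t.
  by have /extP[g [sg cg _]] := gt n I; exists g; rewrite cats0 in cg.
have [H HP] := choice HH; exists H; split.
- by have [/size0nil] := HP 0%N.
- move=> n; have [s1 c1] := HP n.+1; have [s2 c2] := HP n.
  case: (H n.+1) s1 c1 => // e h [sh] [ch _]; exists e; congr (_ :: _).
  by apply: cyl_inj ch c2; rewrite sh.
- by move=> n; have [] := HP n.
- by move=> n; have [] := HP n.
Qed.

(** On [good] every path has a next step, so by monotonicity of [B] the events increase with [n] and
    continuity from below applies. *)
Lemma prob_monotone_event B (c : R) : (forall e h, B h -> B (e :: h)) ->
  (forall n, tsum n (fun g => qw w g * (B g)%:R) [::] <= c) ->
  (Q (\bigcup_n (good `&` ext B n [::])) <= c%:E)%E.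
Proof.
move=> BS Hc; apply: measure_bigcup_nd_le => n.
- by apply: measurableI; [exact: measurable_good|exact: measurable_ext].
- move=> t [gt /extP[g [sg]]]; rewrite cats0 => cg Bg; split=> //.
  have [H [_ HS Hsz Hc']] := good_path gt; have [e He] := HS n.
  apply/extP; exists (e :: g); rewrite cats0; split; [by rewrite /= sg| |exact: BS].
  have := Hc' n.+1; rewrite He; suff -> : H n = g by [].
  by apply: cyl_inj (Hc' n) cg; rewrite Hsz sg.
apply: (@le_trans _ _ (Q (ext B n [::]))).
  by rewrite le_measure// inE; [apply: measurableI; [exact: measurable_good|]|];
    exact: measurable_ext.
by rewrite prob_ext lee_fin.
Qed.

Lemma tsum_below (K : R) n h :
  tsum n (fun g => qw w g * (below l K g)%:R) h
    <= avoid (qw w) (fun g => K <= ht g) n h.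
Proof.
have q0 := qw_ge0 hk0 w.
elim: n h => [|n IH] h; rewrite avoidE; have [Kh|Kh] := leP K (ht h).
- have bf : below l K h = false.
    by apply/negP => /andP[+ _]; rewrite -/(ht h) ltNge Kh.
  by rewrite /tsum bf mulr0.
- by rewrite /tsum ler_piMr// lern1 leq_b1.
- rewrite (eq_tsum (G := fun g => 0 * qw w g)) ?tsumZ ?mul0r// => g _.
  have [bg|] := boolP (below l K (g ++ h)); last by rewrite mulr0 mul0r.
  have : pos h \in visited (g ++ h) by rewrite sub_visited// mem_head.
  by move=> /(allP bg); rewrite ltNge -/(ht h) Kh.
- by apply: ler_sum => e _; exact: IH.
Qed.

(** Three kinds of null sets are removed: the complement of [good]; [low K], where the walk stays
    below [K] for ever; and [bad k], where infinitely many trials above [k] fail. Elsewhere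
    [trials_escape] applies at every level. *)
Lemma transient_of_trials (m : nat) :
  (forall (k : nat) (eps : R), 0 < eps -> exists N : nat, forall n,
     tsum n (fun g => qw w g * (N <= fails l k%:R m g)%N%:R) [::] <= eps) ->
  transient_in_direction l X.
Proof.
move=> Hfail.
pose low (K : nat) := \bigcap_n ext (below l K%:R) n [::].
pose bad (k : nat) := \bigcap_N \bigcup_n
  (good `&` ext (fun g => (N <= fails l k%:R m g)%N) n [::]).
have mext B n : measurable (ext B n [::]) by exact: measurable_ext.
have nlow K : Q.-negligible (low K).
  have mlow : measurable (low K) by exact: bigcapT_measurable.
  apply/negligibleP => //; apply: measure_le_eps0 => // eps eps0.
  have [N HN] := avoid_level_small hd hl hk0 (qw_walk_weight hk0 w) K%:R eps0.
  apply: (@le_trans _ _ (Q (ext (below l K%:R) N [::]))).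
    by rewrite le_measure ?inE// => t; exact.
  rewrite prob_ext lee_fin; apply: (le_trans (tsum_below _ _ _)).
  by have := HN K%:R [::] N (leqnn _); rewrite ht_nil subrr mulr1; exact.
have nbad k : Q.-negligible (bad k).
  have mU N : measurable (\bigcup_n
      (good `&` ext (fun g => (N <= fails l k%:R m g)%N) n [::])).
    apply: bigcupT_measurable => n; apply: measurableI => //.
    exact: measurable_good.
  have mbad : measurable (bad k) by exact: bigcapT_measurable.
  apply/negligibleP => //; apply: measure_le_eps0 => // eps eps0.
  have [N HN] := Hfail k eps eps0.
  apply: (@le_trans _ _ (Q (\bigcup_n
      (good `&` ext (fun g => (N <= fails l k%:R m g)%N) n [::])))).
    by rewrite le_measure ?inE// => t; exact.
  apply: prob_monotone_event => // e h /leq_trans; apply; exact: fails_homo.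
apply: (@negligibleS _ _ _ _
  (~` good `|` (\bigcup_K low K `|` \bigcup_k bad k))); last first.
  apply: negligibleU.
    apply/negligibleP; last exact: prob_not_good.
    by apply: measurableC; exact: measurable_good.
  by apply: negligibleU; exact: negligible_bigcup.
move=> t; apply: contra_notP => /not_orP[/contrapT gt /not_orP[nl nb]] /=.
have [H [H0 HS Hsz Hcyl]] := good_path gt.
have Hsup (K : R) : exists n, K <= ht (H n).
  pose K' := (Num.truncn `|K|).+1.
  have KK : K <= K'%:R by apply: le_trans (ler_norm _) _; rewrite ltW// truncnS_gt.
  apply: contrapT => /forallNP HK; apply: nl; exists K' => // n _.
  have lt k : ht (H k) < K'%:R.
    by rewrite (lt_le_trans _ KK)// ltNge; apply/negP/HK.
  apply/extP; exists (H n); rewrite cats0; split=> //.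
  elim: n => [|n IH]; last first.
    by have [e He] := HS n; have := lt n.+1; rewrite He below_cons IH andbT.
  by rewrite /below H0 /= andbT; have := lt 0%N; rewrite H0.
apply/cvgryPge => A.
pose k := (Num.truncn `|A|).+1.
have Ak : A <= k%:R by apply: le_trans (ler_norm _) _; rewrite ltW// truncnS_gt.
have [N HN] : exists N, forall n, (fails l k%:R m (H n) < N)%N.
  apply: contrapT => /forallNP HN; apply: nb; exists k => // N _.
  have /existsNP[n /negP nN] := HN N; rewrite -leqNgt in nN.
  by exists n => //; split=> //; apply/extP; exists (H n); rewrite cats0.
have [n0 Hn0] := trials_escape H0 HS Hsup HN.
exists n0 => // n /= n0n; apply: (le_trans Ak).
by have := Hn0 n n0n; rewrite /height -(cyl_last (Hcyl n)) Hsz.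
Qed.

End Walk.

(** * Transience *)

Section Main.
Context {R : realType} {d : nat} (l : 'rV[R]_d) (kappa : R).
Context (hd : (2 <= d)%N) (hk0 : 0 < kappa) (hk1 : kappa <= (2 * d%:R)^-1).
Hypothesis hl : \sum_(j < d) `|l 0 j| = 1.
Local Notation Omega := (environment l hd hk0 hk1).
Variable P : probability (borel Omega) R.
Hypothesis hiid : iid P (env_site : lattice d -> borel Omega ->
                              borel (site_env R d)).
Hypothesis hdrift : (0 < \int[P]_w drift 0%R w)%E.
Implicit Types (h g : seq (step d)) (w : borel Omega).

Local Notation E f := (\int[P]_w f w).
Local Notation aw := (aw P).

(** The terms of [drift] are nonnegative, so its mean is the sum of the [mean_drift P i], which
    cannot all vanish. *)
Lemma exists_mean_drift : exists i, 0 < mean_drift P i.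
Proof.
apply: contrapT => /forallNP H0.
have D0 i : mean_drift P i = 0.
  apply/eqP; rewrite eq_le leNgt Exp_ge0 ?andbT => [|w]; first exact/negP.
  exact: (sdrift_ge0 w).
suff : (\int[P]_w drift 0%R w = 0)%E by move=> E0; move: hdrift; rewrite E0 ltxx.
rewrite /drift integral_nneseries//=.
- rewrite eseries0// => i _ _; rewrite -[LHS]/(\int[P]_w (sdrift w 0 i)%:E)%E.
  rewrite EFin_Exp; last exact: bm_sdrift.
  by have := D0 i; rewrite /mean_drift => ->.
- by move=> i; apply/measurable_EFinP; have [] := bm_sdrift l hd hk0 hk1 0 i.
- by move=> i w _; rewrite lee_fin; exact: (sdrift_ge0 w).
Qed.

Lemma exists_escape : exists t c, [/\ 0 < c, c <= 1 &
  forall n h, is_record l h -> c * aw h <= escapes l aw t n h].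
Proof.
have [i Di] := exists_mean_drift.
have ww := aw_walk_weight P.
have k1 := kappa_le1 hd hk1.
have cD : 0 < kappa ^+ (2 * i) * mean_drift P i by rewrite mulr_gt0 ?exprn_gt0.
have [t Ht] := @escape_probability _ _ _ _ hd hl hk0 _ ww
  (kappa ^+ (2 * i) * mean_drift P i)^-1 (fun K n => etrans
    (ler_pdivlMl _ _ cD) (fresh_points_le hl hiid K n i)).
exists t, (kappa ^+ t * (1 / 4)); split.
- by rewrite mulr_gt0 ?exprn_gt0.
- by apply: mulr_ile1; rewrite ?exprn_ile1 ?exprn_ge0 ?(ltW hk0)//; lra.
- apply: (uniform_escape hiid) => n; have [h rh Hh] := Ht n.
  by exists h => //; rewrite mulrA mulr1.
Qed.

Lemma markov_bound (f : borel Omega -> R) (eps c : R) : 0 < eps -> bm f ->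
  (forall w, 0 <= f w) -> E f <= c * eps -> (P [set w | (eps < f w)%R] <= c%:E)%E.
Proof.
move=> eps0 bf f0 fc.
have mA : measurable [set w | eps < f w].
  rewrite -[X in measurable X]setTI (_ : [set w | _] = f @^-1` `]eps, +oo[%classic).
    by apply: bf.1.
  by apply/seteqP; split => w /=; rewrite in_itv/= andbT.
have bA : bm (\1_[set w | eps < f w] : borel Omega -> R).
  split; first exact: measurable_indic.
  by exists 1 => w; rewrite indicE ger0_norm// lern1 leq_b1.
rewrite -(@fineK _ (P _)) ?fin_num_measure// lee_fin -(ler_pM2r eps0).
apply: le_trans fc; rewrite -Exp_indic// mulrC -ExpZ//.
apply: Exp_le => //; first exact: bmZ.
move=> w; rewrite indicE; have [|_] := boolP (w \in _); last by rewrite mulr0.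
by rewrite inE mulr1 => /ltW.
Qed.

(** On average over the environment, [N] failures have probability at most [rho ^ N] at every
    horizon. Markov's inequality and continuity from below carry this over to almost every
    environment as [N] grows. *)
Lemma few_fails (t : nat) (c : R) : 0 < c -> c <= 1 ->
  (forall n h, is_record l h -> c * aw h <= escapes l aw t n h) ->
  {ae P, forall w, forall (k : nat) (eps : R), 0 < eps -> exists N : nat, forall n,
     tsum n (fun g => qw w g * (N <= fails l k%:R t g)%N%:R) [::] <= eps}.
Proof.
move=> c0 c1 Hc; have ww := aw_walk_weight P.
pose rho := 1 - c.
have rho01 : 0 <= rho <= 1 by apply/andP; split; rewrite /rho; lra.
have Hrho n h : is_record l h ->
    tsum t (hit aw (fun g => height l g < height l h) n) h <= rho * aw h.
  move=> rh; have := Hc n h rh; rewrite /escapes /rho.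
  have : tsum t aw h = tsum t (hit aw (fun g => height l g < height l h) n) h +
      tsum t (avoid aw (fun g => height l g < height l h) n) h.
    by rewrite -tsumD; apply: eq_tsum => g _; rewrite hit_avoid//; exact: (ww_sum ww).
  rewrite (tsumW (ww_sum ww)); lra.
pose G (k N n : nat) w :=
  tsum n (fun g => qw w g * (N <= fails l k%:R t g)%N%:R) [::].
have bG k N n : bm (G k N n).
  by apply: bm_tsum => g; apply: bmM; [exact: bm_qw|exact: bm_cst].
have EG k N n : E (G k N n) <= rho ^+ N.
  rewrite Exp_tsum => [|g]; last by apply: bmM; [exact: bm_qw|exact: bm_cst].
  have := mass_fails k%:R (ww_ge0 hk0 ww) (ww_sum ww) rho01 Hrho N n (ww_nil ww).
  apply: le_trans; apply: ler_tsum => g _.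
  rewrite mulrC -ExpZ; last exact: bm_qw.
  by under eq_Rintegral do rewrite mulrC.
have G0 k N n w : 0 <= G k N n w.
  by apply: tsum_ge0 => g; rewrite mulr_ge0// qw_ge0.
(* The thresholds [1 / (j + 1)] replace all [eps], so that the exceptional set is a countable
   union. *)
pose bad (k j : nat) := \bigcap_N \bigcup_n [set w | j.+1%:R^-1 < G k N n w].
have mbad1 k N j n : measurable [set w | j.+1%:R^-1 < G k N n w].
  rewrite -[X in measurable X]setTI
    (_ : [set w | _] = G k N n @^-1` `]j.+1%:R^-1, +oo[%classic).
    by apply: (bG k N n).1.
  by apply/seteqP; split => w /=; rewrite in_itv/= andbT.
have nbad k j : P.-negligible (bad k j).
  have mU N : measurable (\bigcup_n [set w | j.+1%:R^-1 < G k N n w]).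
    exact: bigcupT_measurable.
  apply/negligibleP; first exact: bigcapT_measurable.
  apply: measure_le_eps0 => // eps eps0.
  have [N HN] : exists N, rho ^+ N <= eps * j.+1%:R^-1.
    have e0 : 0 < eps * j.+1%:R^-1 by rewrite mulr_gt0.
    have rho1 : `|rho| < 1 by rewrite ger0_norm ?(andP rho01).1// /rho; lra.
    have /cvgr0Pnorm_le /(_ _ e0) [N _ HN] := cvg_expr rho1.
    by exists N; apply: le_trans (ler_norm _) _; exact: HN N (leqnn N).
  apply: (@le_trans _ _ (P (\bigcup_n [set w | (j.+1%:R^-1 < G k N n w)%R]))).
    rewrite le_measure ?inE//; first exact: bigcapT_measurable.
    by move=> w; exact.
  apply: measure_bigcup_nd_le => // [n w /= lt|n].
    apply: (lt_le_trans lt); rewrite /G -[n.+1]addn1.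
    apply: (tsum_homo (qw_ge0 hk0 w) (ww_sum (qw_walk_weight hk0 w))
      (F := fun g => (N <= fails l k%:R t g)%N%:R)) => e g.
    rewrite ler_nat; case: (leqP N (fails _ _ _ g)) => // /leq_trans->//.
    exact: fails_homo.
  apply: markov_bound => //.
  exact: le_trans (EG k N n) HN.
apply: (@negligibleS _ _ _ _ (\bigcup_k \bigcup_j bad k j)); last first.
  by do 2 apply: negligible_bigcup => ?; exact: nbad.
move=> w; apply: contra_notP => nb /= k eps eps0.
pose j := Num.truncn eps^-1.
have je : j.+1%:R^-1 <= eps.
  by rewrite invf_ple ?posrE// ltW// truncnS_gt.
apply: contrapT => /forallNP HN; apply: nb; exists k => //; exists j => // N _.
have /existsNP[n /negP nle] := HN N; exists n => //=.
by apply: (le_lt_trans je); rewrite ltNge.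
Qed.

End Main.

Theorem theorem1 (R : realType) (d : nat) (hd : (2 <= d)%N)
  (l : 'rV[R]_d) (hl : \sum_(j < d) `|l 0 j| = 1)
  (kappa : R) (hk0 : 0 < kappa) (hk1 : kappa <= (2 * d%:R)^-1)
  (P : probability (borel (environment l hd hk0 hk1)) R)
  (hiid : iid P (env_site : lattice d -> borel (environment l hd hk0 hk1) ->
                              borel (site_env R d)))
  (hdrift : (0 < \int[P]_w drift 0%R w)%E) :
  {ae P, forall w : environment l hd hk0 hk1,
     forall (dT : measure_display) (T : measurableType dT)
            (Q : probability T R) (X : nat -> {RV Q >-> lattice d}),
       is_ERW 0 w X -> transient_in_direction l X}.
Proof.
have [t [c [c0 c1 Hc]]] := exists_escape hl hiid hdrift.
apply: filterS (few_fails c0 c1 Hc) => w Hw dT T Q X HX.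
exact: (transient_of_trials hd hl hk0 HX Hw).
Qed.
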